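(* Let $\mathcal{H}$ be a nonzero complex Hilbert space, let $A\in\mathcal{B}(\mathcal{H})$, and let $f$ be a non-negative increasing operator convex function on $[0,\infty)$. Then for all $\alpha\in[0,1]$, $$f(w^2(A))\le\left\|\int_0^1 f\left((1-t)\left(\alpha|A|^2+(1-\alpha)|A^*|^2\right)+t\,w^2(A)I\right)dt\right\|\le\left\|f\left(\alpha|A|^2+(1-\alpha)|A^*|^2\right)\right\|.$$
   Context: $\mathcal{B}(\mathcal{H})$ is the set of bounded linear operators on $\mathcal{H}$, $A^*$ is the adjoint of $A$, $|A|=(A^*A)^{1/2}$, $I$ is the identity operator, and $\|\cdot\|$ is the operator norm. The numerical radius is $w(A)=\sup\{|\langle Ax,x\rangle| : x\in\mathcal{H},\ \|x\|=1\}$, and $w^2(A)=(w(A))^2$. A real-valued continuous function $f$ on an interval $J$ is operator convex if for all selfadjoint operators $S,T\in\mathcal{B}(\mathcal{H})$ with spectra contained in $J$ one has $f((1-t)S+tT)\le(1-t)f(S)+tf(T)$ for all $t\in[0,1]$, where $f$ of a selfadjoint operator is given by the continuous functional calculus and $\le$ is the usual order on selfadjoint operators. The integral is the integral over $[0,1]$ of a norm-continuous operator-valued function. *)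

(* Defs.v *)
From HB Require Import structures.
From mathcomp Require Import all_boot all_order all_algebra.
From mathcomp Require Import complex sesquilinear.
From mathcomp Require Import all_classical all_reals all_analysis.

Set Implicit Arguments.
Unset Strict Implicit.
Unset Printing Implicit Defensive.

Import Order.TTheory GRing.Theory Num.Theory Num.Def.
Import numFieldNormedType.Exports.

Local Open Scope classical_set_scope.
Local Open Scope complex_scope.
Local Open Scope ring_scope.

(* Operators on a complex Hilbert space are plain functions [H -> H], added,
   scaled and composed pointwise; B(H) is the set [bounded_operator].
   The inner product [dot] is linear in its first argument.  Norms on [H] and
   on [R[i]] take values in [R[i]] and are real there, hence [complex.Re]. *)

Section BoundedOperators.
Context {R : realType} {H : completeNormedModType R[i]}.
Implicit Types (S T A B : H -> H) (f : R -> R).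

Definition bounded_operator T : Prop :=
  linear T /\ exists M : R, forall x, `|T x| <= M%:C * `|x|.

Definition opnorm T : R :=
  sup [set complex.Re `|T x| | x in [set x : H | `|x| <= 1]].

Definition spectrum T : set R[i] :=
  [set z | ~ exists S, [/\ bounded_operator S,
       S \o (T - z *: idfun) = idfun & (T - z *: idfun) \o S = idfun]].

Definition real_spectrum T : set R := [set r | spectrum T r%:C].

Definition poly_operator (p : {poly R}) T : H -> H :=
  \sum_(i < size p) (p`_i)%:C *: iter i T.

(* Continuous functional calculus of a selfadjoint operator: f(T) is the norm
   limit of p_n(T) for real polynomials p_n converging to f uniformly on the
   spectrum of T, which is then real. *)
Definition is_funcalc f T B : Prop :=
  bounded_operator B /\
  exists2 p : nat -> {poly R},
    {uniform real_spectrum T, (fun n r => (p n).[r]) @ \oo --> f} &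
    opnorm (poly_operator (p n) T - B) @[n --> \oo] --> (0 : R).

Definition funcalc f T : H -> H := xget 0 [set B | is_funcalc f T B].

(* Riemann integral of an operator-valued function, in operator norm; the
   subdivision of [a, b] is [a :: s], with tags [c 0], [c 1], ... *)
Definition tagged_partition (a b : R) (s : seq R) (c : nat -> R) : Prop :=
  itv_partition a b s /\
  forall i, (i < size s)%N -> nth b (a :: s) i <= c i <= nth b (a :: s) i.+1.

Definition mesh_lt (a b : R) (s : seq R) (d : R) : Prop :=
  forall i, (i < size s)%N -> nth b (a :: s) i.+1 - nth b (a :: s) i < d.

Definition riemann_sum (a b : R) (s : seq R) (c : nat -> R)
    (F : R -> H -> H) : H -> H :=
  \sum_(i < size s) (nth b (a :: s) i.+1 - nth b (a :: s) i)%:C *: F (c i).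

Definition is_op_integral (a b : R) (F : R -> H -> H) B : Prop :=
  bounded_operator B /\
  forall e : R, 0 < e -> exists2 d : R, 0 < d &
    forall s c, tagged_partition a b s c -> mesh_lt a b s d ->
      opnorm (riemann_sum a b s c F - B) < e.

Definition op_integral (a b : R) (F : R -> H -> H) : H -> H :=
  xget 0 [set B | is_op_integral a b F B].

Variable dot : {dot H for (@conjC R[i])}.

Definition numerical_radius T : R :=
  sup [set complex.Re `|dot (T x) x| | x in [set x : H | `|x| = 1]].

Definition is_adjoint A B : Prop :=
  bounded_operator B /\ forall x y, dot (A x) y = dot x (B y).

Definition adjoint A : H -> H := xget 0 [set B | is_adjoint A B].

Definition selfadjoint T : Prop := bounded_operator T /\ adjoint T = T.

Definition op_abs A : H -> H := funcalc Num.sqrt (adjoint A \o A).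

(* The order of [R[i]] makes [0 <= z] include that [z] is real. *)
Definition op_le S T : Prop := forall x, 0 <= dot ((T - S) x) x.

Definition operator_convex (J : interval R) f : Prop :=
  {within [set` J], continuous f} /\
  forall S T, selfadjoint S -> selfadjoint T ->
    spectrum S `<=` [set r%:C | r in [set` J]] ->
    spectrum T `<=` [set r%:C | r in [set` J]] ->
    forall t : R, 0 <= t <= 1 ->
      op_le (funcalc f ((1 - t)%:C *: S + t%:C *: T))
            ((1 - t)%:C *: funcalc f S + t%:C *: funcalc f T).

End BoundedOperators.

(* Main.v *)
(** Let [B] be the convex combination of [|A|^2] and [|A*|^2], and let [b] be its norm.
    Since [|(A x, x)|] is at most both [|A x|] and [|A* x|], one has
    [|(A x, x)|^2 <= (B x, x)] on unit vectors, so [w(A)^2 <= b]; and [b] lies in the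
    spectrum of [B], which is contained in [[0, b]].  The operator integral is [g(B)]
    for the scalar function [g r = \int_0^1 f ((1 - t) r + t w(A)^2) dt].  As [f] is
    increasing, [f (w(A)^2) <= g b] and [g <= f b] on [[0, b]], and the norm of [h(B)]
    is the supremum of [|h|] over the spectrum, for [h = g] and for [h = f]. *)

Require Import Defs.
From HB Require Import structures.
From mathcomp Require Import all_boot all_order all_algebra.
From mathcomp Require Import complex sesquilinear.
From mathcomp Require Import all_classical all_reals all_analysis.
From mathcomp Require Import ring lra.
Set Implicit Arguments.
Unset Strict Implicit.
Unset Printing Implicit Defensive.
Import Order.TTheory GRing.Theory Num.Theory Num.Def.
Import numFieldNormedType.Exports.
Local Open Scope classical_set_scope.
Local Open Scope complex_scope.
Local Open Scope ring_scope.

(** * Approximation of continuous functions by polynomials *)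

Section RealAnalysis.
Context {R : realType}.
Implicit Types (f : R -> R) (a b : R) (p : {poly R}).

(** The adjoint, [funcalc] and the operator integral are picked by [xget 0], so nothing is known
    about them before existence is proved and, for the last two, uniqueness. Existence comes from
    minimising a quadratic functional (Riesz), from polynomial approximation, and from completeness
    in operator norm. The calculus rests on one fact: for symmetric [T], the norm of [p(T)] is the
    largest value of [|p|] on the spectrum of [T]. It combines polynomial spectral mapping with the
    fact that the norm or its opposite is a spectral value; the latter is obtained from a direct
    estimate, without the spectral radius formula. For every [t] the integrand is a function of the
    same operator [B]. Operator Riemann sums are therefore images of scalar ones, and scalar
    convergence that is uniform on [[0, b]] becomes convergence in norm. The mean value theorem
    gives [g r = f ((1 - u) r + u w(A)^2)] for some [u] in [[0, 1]], a value of [f] at a point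
    between [r] and [w(A)^2]; monotonicity then yields both comparisons. *)

Lemma eventually_invSn_lt (e : R) : 0 < e ->
  exists N, forall n, (N <= n)%N -> n.+1%:R^-1 < e.
Proof.
move=> e0; exists (truncn e^-1) => n Nn; rewrite invf_plt ?posrE ?ltr0n//.
by apply: lt_le_trans (truncnS_gt _) _; rewrite ler_nat ltnS.
Qed.

Lemma continuous_affine (u v : R) : continuous (fun t : R => u + t * v).
Proof.
by move=> t; apply: cvgD; [|apply: cvgM]; [exact: cvg_cst|exact: cvg_id|exact: cvg_cst].
Qed.

(** Compactness gives one [d] for the whole segment. Only [x] is confined to it: [y] may fall
    outside, as happens in [segment_integral_modulus]. *)
Lemma segment_unif_continuous f a b (e : R) : continuous f -> 0 < e ->
  exists2 d : R, 0 < d & forall x y, a <= x <= b -> `|x - y| < d ->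
    `|f x - f y| < e.
Proof.
move=> cf e0.
have /compact_near_coveringP nc := @segment_compact R a b.
have := nc _ (0^'+) (fun d x => forall y, `|x - y| < d -> `|f x - f y| < e) _ _.
case.
  move=> x _.
  have /cvgrPdist_lt /(_ (e / 2)) := cf x.
  rewrite divr_gt0// => /(_ isT) /nbhs_ballP[h /= h0 hx].
  exists (ball x (h / 2), [set d | d < h / 2]) => /=.
    split; first by apply: nbhsx_ballx; rewrite divr_gt0.
    by apply: nbhs_right_lt; rewrite divr_gt0.
  move=> [z d] [/= xz dh] y zy.
  have tri (u v t : R) : `|u - v| <= `|u - t| + `|t - v|.
    by rewrite -[u - v](subrKA t) ler_normD.
  have half (u v t : R) : `|u - v| < h / 2 -> `|v - t| < h / 2 -> `|u - t| < h.
    by move=> uv vt; have := tri u t v; lra.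
  have fz : `|f x - f z| < e / 2.
    by apply: hx; apply: (half _ _ _ xz); rewrite subrr normr0 divr_gt0.
  have fy : `|f x - f y| < e / 2.
    by apply: hx; apply: (half _ _ _ xz); exact: lt_trans dh.
  by have := tri (f z) (f y) (f x); rewrite (distrC (f z) (f x)); lra.
move=> d /= d0 dP; exists (d / 2) => [|x y xab xy]; first by rewrite divr_gt0.
apply: (dP (d / 2)) => //=; last by rewrite divr_gt0.
by rewrite distrC subr0 gtr0_norm ?divr_gt0//; lra.
Qed.

(* The polynomial [\sum_(k <= n) g k * 'C(n, k) * x ^ k * (1 - x) ^ (n - k)], computed
   by Pascal's rule. *)
Fixpoint bernstein (n : nat) (g : nat -> R) : {poly R} :=
  if n is m.+1 then 'X * bernstein m (g \o S) + (1 - 'X) * bernstein m g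
  else (g 0%N)%:P.

Lemma bernsteinS n g x : (bernstein n.+1 g).[x] =
  x * (bernstein n (g \o S)).[x] + (1 - x) * (bernstein n g).[x].
Proof. by rewrite /= !hornerE. Qed.

Lemma bernstein_le n (g h : nat -> R) x : 0 <= x <= 1 ->
  (forall k, (k <= n)%N -> g k <= h k) -> (bernstein n g).[x] <= (bernstein n h).[x].
Proof.
move=> x01; elim: n g h => [|n IH] g h gh; first by rewrite !hornerC gh.
rewrite !bernsteinS; apply: lerD; apply: ler_wpM2l.
- by lra.
- by apply: IH => k kn; apply: gh.
- by lra.
- by apply: IH => k kn; apply/gh/leqW.
Qed.

(** These are the first two moments of the binomial law, with mean [n x] and variance [n x (1 - x)].
    All quadratics are treated at once because the induction shifts [k] to [k.+1], which changes the
    coefficients. *)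
Lemma bernstein_quadratic n (u v w x : R) :
  (bernstein n (fun k => u + v * k%:R + w * k%:R ^+ 2)).[x] =
  u + v * (n%:R * x) + w * (n%:R * x * (1 - x) + (n%:R * x) ^+ 2).
Proof.
elim: n u v w => [|n IH] u v w; first by rewrite hornerC; ring.
rewrite bernsteinS IH.
have -> : (fun k => u + v * k%:R + w * k%:R ^+ 2) \o S =
    (fun k => (u + v + w) + (v + 2 * w) * k%:R + w * k%:R ^+ 2).
  by apply/funext => k /=; rewrite -(natr1 k); ring.
by rewrite IH -(natr1 n); ring.
Qed.

(** Close points are handled by uniform continuity. At distance at least [d], the factor
    [(x - y)^2 / d^2] is at least 1 and absorbs the crude bound [2 max |f|]. *)
Lemma continuous_quadratic_modulus f (e : R) : continuous f -> 0 < e ->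
  exists2 K : R, 0 <= K & forall x y, 0 <= x <= 1 -> 0 <= y <= 1 ->
    `|f x - f y| <= e + K * (x - y) ^+ 2.
Proof.
move=> cf e0; have [d d0 dP] := segment_unif_continuous 0 1 cf e0.
have cfw : {within `[0, 1], continuous (fun x => `|f x|)}.
  apply: continuous_subspaceT => x; apply: continuous_comp; first exact: cf.
  exact: norm_continuous.
have [c _ cP] := EVT_max ler01 cfw.
exists (2 * `|f c| / d ^+ 2) => [|x y x01 y01]; first by rewrite divr_ge0 ?sqr_ge0 ?mulr_ge0.
have [xy|xy] := ltP `|x - y| d.
  have : 0 <= 2 * `|f c| / d ^+ 2 * (x - y) ^+ 2.
    by rewrite mulr_ge0 ?divr_ge0 ?sqr_ge0 ?mulr_ge0.
  by have := dP _ _ x01 xy; lra.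
have fx : `|f x| <= `|f c| by apply: cP; rewrite in_itv.
have fy : `|f y| <= `|f c| by apply: cP; rewrite in_itv.
have fxy := ler_normB (f x) (f y).
suff : 2 * `|f c| <= 2 * `|f c| / d ^+ 2 * (x - y) ^+ 2 by lra.
rewrite mulrAC -mulrA ler_peMr ?mulr_ge0//.
rewrite ler_pdivlMr ?exprn_gt0// mul1r -[leRHS]real_normK ?num_real//.
by rewrite ler_sqr ?nnegrE// ltW.
Qed.

(** For fixed [x], [f] lies between two quadratics centred at [x]. Bernstein polynomials preserve
    order and are explicit on quadratics, where the variance contributes only [K x (1 - x) / n]. *)
Lemma weierstrass01 f (e : R) : continuous f -> 0 < e ->
  exists p, forall x, 0 <= x <= 1 -> `|p.[x] - f x| <= e.
Proof.
move=> cf e0.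
have [K K0 KP] := @continuous_quadratic_modulus f (e / 2) cf ltac:(lra).
pose n := (truncn (K / e)).+1.
have n0 : 0 < n%:R :> R by rewrite ltr0n.
have nK : K / e < n%:R by apply: truncnS_gt.
exists (bernstein n (fun k => f (k%:R / n%:R))) => x x01.
(* The signs [s = 1] and [s = -1] give the upper and the lower quadratic, sampled at the nodes
   [k / n]. *)
pose q s k := f x + s * (e / 2 + K * (k%:R / n%:R - x) ^+ 2).
have qE s : (bernstein n (q s)).[x] = f x + s * (e / 2 + K * (x * (1 - x) / n%:R)).
  transitivity (bernstein n (fun k => (f x + s * (e / 2) + s * K * x ^+ 2)
    + (- 2 * s * K * x / n%:R) * k%:R + (s * K / n%:R ^+ 2) * k%:R ^+ 2)).[x].
    congr (bernstein n _).[x]; apply/funext => k; rewrite /q; field.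
    exact: lt0r_neq0.
  by rewrite bernstein_quadratic; field; exact: lt0r_neq0.
have bnd : K * (x * (1 - x) / n%:R) <= e / 2.
  have xx : x * (1 - x) <= 2^-1 by nra.
  rewrite mulrA ler_pdivrMr//.
  have : K <= e * n%:R by move: nK; rewrite ltr_pdivrMr//; lra.
  have : 0 <= x * (1 - x) by nra.
  by nra.
have kn k : (k <= n)%N -> 0 <= (k%:R / n%:R : R) <= 1.
  by move=> kn; rewrite divr_ge0 ?ler0n//= ler_pdivrMr// mul1r ler_nat.
have up : (bernstein n (fun k => f (k%:R / n%:R))).[x] <= (bernstein n (q 1)).[x].
  apply: bernstein_le => // k /kn k01; rewrite /q.
  by have := KP _ _ k01 x01; rewrite ler_norml; lra.
have lo : (bernstein n (q (-1))).[x] <= (bernstein n (fun k => f (k%:R / n%:R))).[x].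
  apply: bernstein_le => // k /kn k01; rewrite /q.
  by have := KP _ _ k01 x01; rewrite ler_norml; lra.
by move: up lo; rewrite !qE ler_norml; lra.
Qed.

Lemma weierstrass f a b (e : R) : a < b -> continuous f -> 0 < e ->
  exists p, forall x, a <= x <= b -> `|p.[x] - f x| <= e.
Proof.
move=> ab cf e0; have ba : 0 < b - a by lra.
have [|p pP] := @weierstrass01 (fun t => f (a + t * (b - a))) e _ e0.
  move=> t; apply: (@continuous_comp R R R (fun t => a + t * (b - a)) f t); last exact: cf.
  exact: continuous_affine.
exists (p \Po ((b - a)^-1 *: ('X - a%:P))) => x xab.
rewrite horner_comp !hornerE.
have {2}-> : x = a + (b - a)^-1 * (x - a) * (b - a) by field; rewrite lt0r_neq0.
apply: pP; rewrite mulr_ge0 ?invr_ge0//; try lra.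
by rewrite mulrC ler_pdivrMr//; lra.
Qed.

Lemma continuous_antiderivative f a b : continuous f -> a < b ->
  exists F : R -> R, forall x, a <= x <= b -> is_derive x 1 F (f x).
Proof.
move=> cf ab.
(* Enlarging the interval to [[a - 1, b + 1]] makes [a] and [b] interior, so the derivative there is
   two-sided. *)
exists (fun x => \int[lebesgue_measure]_(t in `[a - 1, x]) f t)%R => x xab.
have [||df dfE] := @continuous_FTC1_closed R f (a - 1) x (b + 1) ltac:(lra) _ ltac:(lra).
  apply: continuous_compact_integrable; first exact: segment_compact.
  exact: continuous_subspaceT.
  exact: cf.
by rewrite derive1E in dfE; exact: DeriveDef df dfE.
Qed.

End RealAnalysis.

(** * Hilbert spaces *)

Section LinearMaps.
Context {K : nzRingType} {U V : lmodType K}.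
Variables (T : U -> V) (linT : linear T).

Lemma linmapD x y : T (x + y) = T x + T y.
Proof. by have := linT 1 x y; rewrite !scale1r. Qed.

Lemma linmap0 : T 0 = 0.
Proof. by apply: (@addrI _ (T 0)); rewrite -linmapD !addr0. Qed.

Lemma linmapZ k x : T (k *: x) = k *: T x.
Proof. by have := linT k x 0; rewrite linmap0 !addr0. Qed.

Lemma linmapN x : T (- x) = - T x.
Proof. by rewrite -scaleN1r linmapZ scaleN1r. Qed.

Lemma linmapB x y : T (x - y) = T x - T y.
Proof. by rewrite linmapD linmapN. Qed.

End LinearMaps.

(* Norms take values in [R[i]]; [rnorm] is their real value. *)
Notation rnorm x := (complex.Re `|x|).

Section RealNorm.
Context {R : realType} {H : normedModType R[i]}.
Implicit Types x y z : H.

Lemma normE x : `|x| = (rnorm x)%:C.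
Proof. by rewrite RRe_real// normr_real. Qed.

Lemma rnorm_ge0 x : 0 <= rnorm x.
Proof. by rewrite -lecR -normE; exact: normr_ge0. Qed.

Lemma rnorm0 : rnorm (0 : H) = 0.
Proof. by rewrite normr0. Qed.

Lemma rnorm_eq0 x : (rnorm x == 0) = (x == 0).
Proof.
apply/eqP/eqP => [x0|->]; last exact: rnorm0.
by apply/eqP; rewrite -normr_eq0 normE x0.
Qed.

Lemma rnormB x y : rnorm (x - y) = rnorm (y - x).
Proof. by rewrite distrC. Qed.

Lemma rnormD x y : rnorm (x + y) <= rnorm x + rnorm y.
Proof. by rewrite -lecR rmorphD/= -!normE ler_normD. Qed.

Lemma rnorm_tri z x y : rnorm (x - y) <= rnorm (x - z) + rnorm (z - y).
Proof. by rewrite -[x - y](subrKA z) rnormD. Qed.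

Lemma rnormZ (k : R[i]) x : rnorm (k *: x) = rnorm k * rnorm x.
Proof. by rewrite normrZ normE (normE x) -rmorphM. Qed.

Lemma rnorm_realC (r : R) : rnorm r%:C = `|r|.
Proof. by rewrite normc_def/= expr0n/= addr0 sqrtr_sqr. Qed.

Lemma rnormZr (r : R) x : rnorm (r%:C *: x) = `|r| * rnorm x.
Proof. by rewrite rnormZ rnorm_realC. Qed.

Lemma rnormC_ge0 (k : R[i]) : 0 <= rnorm k.
Proof. by rewrite -lecR RRe_real ?normr_real//; exact: normr_ge0. Qed.

Lemma norm_leZE (M : R) x y : (`|x| <= M%:C * `|y|) = (rnorm x <= M * rnorm y).
Proof. by rewrite (normE x) (normE y) -rmorphM lecR. Qed.

Lemma normr_Re_le (z : R[i]) : `|complex.Re z| <= rnorm z.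
Proof. by rewrite -lecR RRe_real ?normr_real// normc_ge_Re. Qed.

End RealNorm.

Lemma rnorm_complete {R : realType} {H : completeNormedModType R[i]} (u : nat -> H) :
  (forall e : R, 0 < e -> exists n0, forall m n, (n0 <= m)%N -> (n0 <= n)%N ->
     rnorm (u m - u n) < e) ->
  exists z, forall e : R, 0 < e -> exists n0, forall n, (n0 <= n)%N -> rnorm (u n - z) < e.
Proof.
move=> uC; have : cvg (u @ \oo).
  apply/cauchy_cvgP/cauchy_ballP => e e0.
  have eE : e = (complex.Re e)%:C by rewrite RRe_real// gtr0_real.
  have [|n0 n0P] := uC (complex.Re e); first by rewrite -ltcR -eE.
  pose tail : set H := [set x | exists2 n, (n0 <= n)%N & x = u n].
  exists (tail, tail) => /=; first by split; exists n0 => // n /= nn; exists n.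
  move=> [x y] [/= [m mn0 ->] [n nn0 ->]]; rewrite -ball_normE/= eE normE ltcR.
  exact: n0P.
move=> /cvg_ex[z /cvgrPdist_lt uz]; exists z => e e0.
have /uz[n0 _ n0P] : 0 < e%:C by rewrite ltcR.
by exists n0 => n /n0P; rewrite /= normE ltcR rnormB.
Qed.

Section Hilbert.
Context {R : realType} {H : completeNormedModType R[i]}.
Variable dot : {dot H for (@conjC R[i])}.
Hypothesis norm_dot : forall x : H, `|x| ^+ 2 = dot x x.
Implicit Types (x y z : H) (S T A B : H -> H).

(** A real symmetric bilinear form with [rdot x x = |x|^2]; its estimates stay in the ordered field
    [R], within reach of [lra] and [nra]. *)
Definition rdot x y : R := complex.Re (dot x y).

Lemma Re_realM (r : R) (z : R[i]) : complex.Re (r%:C * z) = r * complex.Re z.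
Proof. by case: z => a b /=; rewrite mul0r subr0. Qed.

Lemma ReD (u v : R[i]) : complex.Re (u + v) = complex.Re u + complex.Re v.
Proof. by case: u v => [a b] [c d]. Qed.

Lemma dotC x y : dot x y = (dot y x)^*%C.
Proof.
by rewrite (hermC dot) expr0 mul1r.
Qed.

Lemma rdotC x y : rdot x y = rdot y x.
Proof. by rewrite /rdot dotC; case: (dot y x). Qed.

Lemma rdotDl x y z : rdot (x + y) z = rdot x z + rdot y z.
Proof. by rewrite /rdot linearDl ReD. Qed.

Lemma rdotZl (r : R) x y : rdot (r%:C *: x) y = r * rdot x y.
Proof. by rewrite /rdot linearZl_LR Re_realM. Qed.

Lemma rdotNl x y : rdot (- x) y = - rdot x y.
Proof. by rewrite -scaleN1r -(rmorphN1 (real_complex R)) rdotZl mulN1r. Qed.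

Lemma rdotBl x y z : rdot (x - y) z = rdot x z - rdot y z.
Proof. by rewrite rdotDl rdotNl. Qed.

Lemma rdotDr x y z : rdot z (x + y) = rdot z x + rdot z y.
Proof. by rewrite rdotC rdotDl !(rdotC z). Qed.

Lemma rdotNr x y : rdot x (- y) = - rdot x y.
Proof. by rewrite rdotC rdotNl rdotC. Qed.

Lemma rdotBr x y z : rdot z (x - y) = rdot z x - rdot z y.
Proof. by rewrite rdotC rdotBl !(rdotC z). Qed.

Lemma rdotZr (r : R) x y : rdot x (r%:C *: y) = r * rdot x y.
Proof. by rewrite rdotC rdotZl rdotC. Qed.

Lemma rdot0l x : rdot 0 x = 0.
Proof. by rewrite /rdot linear0l. Qed.

Lemma rdotxx x : rdot x x = rnorm x ^+ 2.
Proof. by rewrite /rdot -norm_dot normE -rmorphXn. Qed.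

(** Cauchy-Schwarz: expand the squared norms of [|y| x + |x| y] and [|y| x - |x| y], both
    nonnegative. *)
Lemma rdot_le x y : `|rdot x y| <= rnorm x * rnorm y.
Proof.
have [x0|x0] := eqVneq x 0.
  by rewrite /rdot x0 linear0l rnorm0 mul0r normr0.
have [y0|y0] := eqVneq y 0.
  by rewrite rdotC /rdot y0 linear0l rnorm0 mulr0 normr0.
have nx : 0 < rnorm x by rewrite lt_def rnorm_eq0 x0 rnorm_ge0.
have ny : 0 < rnorm y by rewrite lt_def rnorm_eq0 y0 rnorm_ge0.
have nxy : 0 < rnorm x * rnorm y by rewrite mulr_gt0.
have := sqr_ge0 (rnorm ((rnorm y)%:C *: x + (rnorm x)%:C *: y)).
have := sqr_ge0 (rnorm ((rnorm y)%:C *: x - (rnorm x)%:C *: y)).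
rewrite -!rdotxx !(rdotDl, rdotNl, rdotDr, rdotNr, rdotZl, rdotZr) !rdotxx (rdotC y x).
rewrite ler_norml => h1 h2; apply/andP; split.
  by rewrite -(ler_pM2l nxy); nra.
by rewrite -(ler_pM2l nxy); nra.
Qed.

Lemma dot_le x y : rnorm (dot x y) <= rnorm x * rnorm y.
Proof.
have [->|d0] := eqVneq (dot x y) 0; first by rewrite rnorm0 mulr_ge0 ?rnorm_ge0.
(* Multiplying [x] by this unit phase makes the inner product real and nonnegative, which reduces
   the claim to [rdot_le]. *)
pose k := (dot x y)^*%C / `|dot x y|.
have nk : `|k| = 1.
  by rewrite /k normrM normfV normr_id normcJ divff// normr_eq0.
have : dot (k *: x) y = `|dot x y|.
  rewrite linearZl_LR /k mulrAC [_^*%C * _]mulrC -sqr_normc expr2 mulfK//.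
  by rewrite normr_eq0.
move=> /(congr1 (@complex.Re R)) <-.
apply: le_trans (ler_norm _) _; apply: le_trans (rdot_le _ _) _.
by rewrite rnormZ nk mul1r.
Qed.

Lemma dot_inj y z : (forall x, dot x y = dot x z) -> y = z.
Proof.
move=> yz; apply/eqP; rewrite -subr_eq0 -(dnorm_eq0 dot) linearBr.
by rewrite subr_eq0; apply/eqP; exact: yz.
Qed.

(* Minimise [Re (S x, x) - 2 Re (phi x)]: by the parallelogram identity minimising
   sequences are Cauchy.  The case [S = id] is the Riesz representation theorem, the
   case [phi = (., y)] solves [S z = y]. *)
Lemma coercive_riesz S (phi : H -> R[i]) (K M c : R) :
  linear S -> (forall x, rnorm (S x) <= K * rnorm x) ->
  (forall x y, dot (S x) y = dot x (S y)) ->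
  0 < c -> (forall x, c * rnorm x ^+ 2 <= rdot (S x) x) ->
  scalar phi -> (forall x, rnorm (phi x) <= M * rnorm x) ->
  exists z, forall x, phi x = dot x (S z).
Proof.
move=> lS bS sS c0 cS lphi bphi.
have sSr x y : rdot (S x) y = rdot x (S y) by rewrite /rdot sS.
have phi0 : phi 0 = 0.
  by have := lphi 1 0 0; rewrite scale1r mul1r addr0 -[LHS]addr0 => /addrI.
have rphiD x y : complex.Re (phi (x + y)) = complex.Re (phi x) + complex.Re (phi y).
  have := lphi 1 x y; rewrite scale1r mul1r => ->.
  exact: ReD.
have rphiZ (r : R) x : complex.Re (phi (r%:C *: x)) = r * complex.Re (phi x).
  by have := lphi r%:C x 0; rewrite phi0 !addr0 => ->; rewrite Re_realM.
pose q x := rdot (S x) x - 2 * complex.Re (phi x).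
have q_lb x : - (M ^+ 2 / c) <= q x.
  have : c * rnorm x ^+ 2 - 2 * (M * rnorm x) <= q x.
    have := cS x; have := bphi x; have := normr_Re_le (phi x).
    by rewrite ler_norml /q; lra.
  apply: le_trans; rewrite -subr_ge0.
  rewrite (_ : _ - _ = (c * rnorm x - M) ^+ 2 / c); last by field; exact: lt0r_neq0.
  by rewrite divr_ge0 ?sqr_ge0// ltW.
have hq : has_inf (range q).
  split; first by exists (q 0), 0.
  by exists (- (M ^+ 2 / c)) => _ [x _ <-].
pose m := inf (range q).
have mq x : m <= q x by apply: ge_inf; [exact: hq.2|exists x].
have qm e : 0 < e -> exists x, q x < m + e.
  by move=> e0; have [_ [x _ <-] qx] := inf_adherent e0 hq; exists x.
have qD x y (t : R) : q (x + t%:C *: y) =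
    q x + 2 * t * (rdot y (S x) - complex.Re (phi y)) + t ^+ 2 * rdot (S y) y.
  rewrite /q (linmapD lS) (linmapZ lS) !(rdotDl, rdotDr, rdotZl, rdotZr) rphiD rphiZ.
  by rewrite (sSr y x) (rdotC (S x) y); ring.
(* The value of [q] at the midpoint is at least [m], and by [qD] it is the mean of [q x] and [q y]
   minus a quarter of the form at [y - x]. *)
have qpar x y e1 e2 : q x < m + e1 -> q y < m + e2 ->
    c * rnorm (x - y) ^+ 2 <= 2 * (e1 + e2).
  move=> qx qy; have := cS (y - x); have := mq (x + (2^-1)%:C *: (y - x)).
  have : q y = q (x + 1%:C *: (y - x)) by rewrite scale1r subrKC.
  by rewrite !qD (rnormB x); lra.
have /boolp.choice[u uP] : forall n, exists x, q x < m + n.+1%:R^-1.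
  by move=> n; apply: qm; rewrite invr_gt0 ltr0n.
have [|z uz] := @rnorm_complete _ _ u.
  move=> e e0; have [|n0 n0P] := @eventually_invSn_lt R (c * e ^+ 2 / 4).
    by rewrite divr_gt0// mulr_gt0// exprn_gt0.
  exists n0 => i j /n0P ii /n0P jj.
  rewrite -ltr_sqr ?nnegrE ?rnorm_ge0 ?ltW// -(ltr_pM2l c0).
  move: ii jj (qpar _ _ _ _ (uP i) (uP j)).
  by move: (i.+1%:R^-1) (j.+1%:R^-1) => a b; lra.
have K0 x : 0 <= K * rnorm x := le_trans (rnorm_ge0 _) (bS x).
(* Variations are taken at near-minimisers [x] close to [z], which avoids proving that [q] attains
   [m] at [z]. *)
have approx e : 0 < e -> exists x, q x < m + e /\ rnorm (x - z) < e.
  move=> e0; have [n1 n1P] := eventually_invSn_lt e0; have [n2 n2P] := uz _ e0.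
  exists (u (maxn n1 n2)); split; last by apply: n2P; exact: leq_maxr.
  by apply: lt_le_trans (uP _) _; rewrite lerD2l ltW// n1P// leq_maxl.
have Re_eq y : complex.Re (phi y) = rdot y (S z).
  set C := rdot (S y) y; pose D := rdot y (S z) - complex.Re (phi y).
  have C0 : 0 <= C by apply: le_trans (cS y); rewrite mulr_ge0 ?sqr_ge0 ?ltW.
  (* The increment of [q] from [z] in direction [t y] is nonnegative; [L] collects the two errors
     made by using [x] in place of [z]. *)
  have tP (t : R) : 0 <= 2 * t * D + t ^+ 2 * C.
    pose L := 1 + 2 * `|t| * (rnorm y * `|K|).
    have L0 : 0 < L by rewrite /L ltr_wpDr// !mulr_ge0 ?rnorm_ge0.
    apply/ler_addgt0Pr => e e0; have [x [qx xz]] := approx (e / L) ltac:(exact: divr_gt0).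
    have := mq (x + t%:C *: y); rewrite qD -/C => h.
    have eE : e = e / L + 2 * (`|t| * (rnorm y * `|K|) * (e / L)).
      by rewrite {1}(_ : e = L * (e / L)) ?[in LHS]/L; [ring|field; exact: lt0r_neq0].
    have : `|t * rdot y (S (x - z))| <= `|t| * (rnorm y * `|K|) * (e / L).
      rewrite normrM -!mulrA; apply: ler_wpM2l => //.
      apply: le_trans (rdot_le _ _) _; apply: ler_wpM2l; first exact: rnorm_ge0.
      apply: le_trans (bS _) _; apply: le_trans (ler_wpM2r (rnorm_ge0 _) (ler_norm K)) _.
      by apply: ler_wpM2l => //; exact: ltW.
    rewrite (linmapB lS) rdotBr ler_norml /D; move: eE qx h.
    by lra.
  have /eqP : D = 0.
    (* The minimising [t] is [- D / C]; the denominator [C + 1] also covers [C = 0] and still makes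
       the value a negative multiple of [D ^+ 2]. *)
    have := tP (- D / (C + 1)).
    have C1 : 0 < C + 1 by lra.
    rewrite (_ : _ + _ = - (D ^+ 2 * ((C + 2) / (C + 1) ^+ 2))); last first.
      by field; exact: lt0r_neq0.
    rewrite oppr_ge0 pmulr_lle0 ?divr_gt0 ?exprn_gt0//; last by lra.
    by move=> D2; apply/eqP; rewrite -sqrf_eq0 eq_le D2 sqr_ge0.
  by rewrite subr_eq0 => /eqP.
(* Real parts agree everywhere; evaluating at [i x] recovers the imaginary parts. *)
exists z => x; have h1 := Re_eq x; have := Re_eq ('i%C *: x).
have := lphi 'i%C x 0; rewrite phi0 !addr0 => ->.
rewrite /rdot linearZl_LR !(mulrC 'i%C) !ReiNIm => /oppr_inj.
by move=> h2; apply/eqP; rewrite eq_complex h2 -/(rdot x (S z)) h1 !eqxx.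
Qed.

End Hilbert.

(** * Bounded operators and polynomial spectral mapping *)

Section BoundedOperatorAlgebra.
Context {R : realType} {H : completeNormedModType R[i]}.
Implicit Types (x y z : H) (S T A B : H -> H) (P Q : {poly R[i]}) (p q : {poly R}).

Lemma bounded_operatorP T : bounded_operator T <->
  linear T /\ exists2 M : R, 0 <= M & forall x, rnorm (T x) <= M * rnorm x.
Proof.
split=> [[lT [M MP]]|[lT [M M0 MP]]]; split=> //.
  exists `|M| => // x; have := MP x; rewrite norm_leZE => h.
  by apply: (le_trans h); rewrite ler_wpM2r ?rnorm_ge0// ler_norm.
by exists M => x; rewrite norm_leZE.
Qed.

Lemma bounded_linear T : bounded_operator T -> linear T.
Proof. by case. Qed.

Lemma opnorm_le T (c : R) : 0 <= c -> (forall x, rnorm (T x) <= c * rnorm x) ->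
  opnorm T <= c.
Proof.
move=> c0 Tc; apply: ge_sup.
  by exists (rnorm (T 0)), 0 => //=; rewrite normr0 ler01.
move=> _ [x /= x1 <-]; apply: le_trans (Tc x) _.
by rewrite ler_piMr// -lecR -normE.
Qed.

Lemma opnorm_ge T x : bounded_operator T -> rnorm (T x) <= opnorm T * rnorm x.
Proof.
move=> bT; have lT := bounded_linear bT.
have /bounded_operatorP[_ [M M0 MP]] := bT.
have [->|x0] := eqVneq x 0; first by rewrite (linmap0 lT) !rnorm0 mulr0.
have nx : 0 < rnorm x by rewrite lt_def rnorm_eq0 x0 rnorm_ge0.
have nu : rnorm ((rnorm x)^-1%:C *: x) = 1.
  by rewrite rnormZr gtr0_norm ?invr_gt0// mulVf// lt0r_neq0.
rewrite -ler_pdivrMr// mulrC -[_^-1]gtr0_norm ?invr_gt0// -rnormZr -(linmapZ lT).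
apply: ub_le_sup; last by exists ((rnorm x)^-1%:C *: x); rewrite //= normE nu lexx.
exists M => _ [y /= y1 <-]; apply: le_trans (MP y) _.
by rewrite ler_piMr// -lecR -normE.
Qed.

Lemma opnorm_ge0 T : bounded_operator T -> 0 <= opnorm T.
Proof.
move=> bT; have /bounded_operatorP[_ [M M0 MP]] := bT.
apply: ub_le_sup; last by exists 0; rewrite /= ?normr0 ?ler01// (linmap0 bT.1) normr0.
exists M => _ [y /= y1 <-]; apply: le_trans (MP y) _.
by rewrite ler_piMr// -lecR -normE.
Qed.

Lemma bounded_opnorm T : linear T -> (exists M : R, forall x, rnorm (T x) <= M * rnorm x) ->
  bounded_operator T.
Proof. by move=> lT [M MP]; split=> //; exists M => x; rewrite norm_leZE. Qed.

Lemma bounded_id : bounded_operator (idfun : H -> H).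
Proof. by apply: bounded_opnorm => //; exists 1 => x; rewrite mul1r. Qed.

Lemma boundedD S T : bounded_operator S -> bounded_operator T -> bounded_operator (S + T).
Proof.
move=> bS bT; apply: bounded_opnorm.
  move=> k x y; rewrite !fctE bS.1 bT.1 scalerDr.
  by rewrite -!addrA; congr (_ + _); rewrite addrCA.
exists (opnorm S + opnorm T) => x; rewrite fctE mulrDl.
by apply: le_trans (rnormD _ _) _; rewrite lerD ?opnorm_ge.
Qed.

Lemma boundedZ k T : bounded_operator T -> bounded_operator (k *: T).
Proof.
move=> bT; apply: bounded_opnorm.
  by move=> l x y; rewrite !fctE bT.1 scalerDr !scalerA mulrC.
exists (rnorm k * opnorm T) => x; rewrite fctE rnormZ -mulrA.
by rewrite ler_wpM2l ?opnorm_ge ?rnormC_ge0//.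
Qed.

Lemma boundedN T : bounded_operator T -> bounded_operator (- T).
Proof. by move=> bT; rewrite -scaleN1r; exact: boundedZ. Qed.

Lemma boundedB S T : bounded_operator S -> bounded_operator T -> bounded_operator (S - T).
Proof. by move=> bS bT; apply: boundedD => //; exact: boundedN. Qed.

Lemma bounded_comp S T : bounded_operator S -> bounded_operator T -> bounded_operator (S \o T).
Proof.
move=> bS bT; apply: bounded_opnorm.
  by move=> l x y; rewrite /= bT.1 bS.1.
exists (opnorm S * opnorm T) => x /=.
apply: le_trans (opnorm_ge _ bS) _; rewrite -mulrA.
by rewrite ler_wpM2l ?opnorm_ge0// opnorm_ge.
Qed.

Lemma opnormD S T : bounded_operator S -> bounded_operator T ->
  opnorm (S + T) <= opnorm S + opnorm T.
Proof.
move=> bS bT; apply: opnorm_le => [|x]; first by rewrite addr_ge0 ?opnorm_ge0.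
by rewrite fctE mulrDl; apply: le_trans (rnormD _ _) _; rewrite lerD ?opnorm_ge.
Qed.

Lemma opnormN T : opnorm (- T) = opnorm T.
Proof.
rewrite /opnorm; congr sup; apply/seteqP.
by split=> _ [x x1 <-]; exists x; rewrite // fctE normrN.
Qed.

Lemma opnormB S T : opnorm (S - T) = opnorm (T - S).
Proof. by rewrite -opnormN opprB. Qed.

Lemma opnorm_comp S T : bounded_operator S -> bounded_operator T ->
  opnorm (S \o T) <= opnorm S * opnorm T.
Proof.
move=> bS bT; apply: opnorm_le => [|x /=]; first by rewrite mulr_ge0 ?opnorm_ge0.
apply: le_trans (opnorm_ge _ bS) _; rewrite -mulrA.
by rewrite ler_wpM2l ?opnorm_ge0// opnorm_ge.
Qed.

Lemma opnorm_le0 T : bounded_operator T -> opnorm T <= 0 -> T = 0.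
Proof.
move=> bT T0; apply/funext => x; apply/eqP; rewrite -rnorm_eq0 eq_le rnorm_ge0 andbT.
by apply: le_trans (opnorm_ge _ bT) _; rewrite mulr_le0_ge0 ?rnorm_ge0.
Qed.

(** By conversion, [spectrum T z] is the negation of this for [T - z *: idfun]. *)
Definition invertible_operator T := exists S,
  [/\ bounded_operator S, S \o T = idfun & T \o S = idfun].

Lemma invertible_comp S T : invertible_operator S -> invertible_operator T ->
  invertible_operator (S \o T).
Proof.
move=> [S' [bS SK KS]] [T' [bT TK KT]]; exists (T' \o S'); split.
- exact: bounded_comp.
- by apply/funext => x /=; rewrite -[S' _]/((S' \o S) _) SK -[LHS]/((T' \o T) _) TK.
- by apply/funext => x /=; rewrite -[T (T' _)]/((T \o T') _) KT -[LHS]/((S \o S') _) KS.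
Qed.

Lemma invertible_scale (k : R[i]) : k != 0 -> invertible_operator (k *: idfun).
Proof.
move=> k0; exists (k^-1 *: idfun); split; first exact/boundedZ/bounded_id.
- by apply/funext => x; rewrite /= !fctE scalerA mulVf// scale1r.
- by apply/funext => x; rewrite /= !fctE scalerA mulfV// scale1r.
Qed.

(** If [V] inverts [S \o T], then [V] commutes with [S], so [V \o S] inverts [T] on both sides. *)
Lemma invertible_factor S T : bounded_operator S -> S \o T = T \o S ->
  invertible_operator (S \o T) -> invertible_operator T.
Proof.
move=> bS ST [V [bV VK KV]].
have SVE : V \o S = S \o V.
  apply/funext => x /=.
  have VKx y : V (S (T y)) = y := congr1 (@^~ y) VK.
  rewrite -[RHS]VKx; congr (V (S _)).
  by rewrite -[RHS]/((T \o S) (V x)) -ST -[RHS]/(((S \o T) \o V) x) KV.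
exists (V \o S); split; first exact: bounded_comp.
- by rewrite -compA.
- by rewrite SVE compA -ST.
Qed.

(* Complex coefficients make polynomials in [T] split into linear factors. *)
Definition cpoly P T x := \sum_(i < size P) P`_i *: iter i T x.

Lemma cpolyE n P T x : (size P <= n)%N -> cpoly P T x = \sum_(i < n) P`_i *: iter i T x.
Proof.
move=> Pn; rewrite /cpoly (big_ord_widen n (fun i => P`_i *: iter i T x))//.
rewrite big_mkcond; apply: eq_bigr => i _; case: ifPn => //.
by rewrite -leqNgt => /(nth_default 0)->; rewrite scale0r.
Qed.

Lemma cpolyD P Q T x : cpoly (P + Q) T x = cpoly P T x + cpoly Q T x.
Proof.
pose n := maxn (size P) (size Q).
rewrite !(@cpolyE n) ?leq_maxl ?leq_maxr ?size_polyD// -big_split/=.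
by apply: eq_bigr => i _; rewrite coefD scalerDl.
Qed.

Lemma cpolyZ k P T x : cpoly (k *: P) T x = k *: cpoly P T x.
Proof.
rewrite !(@cpolyE (size P)) ?size_scale_leq// scaler_sumr.
by apply: eq_bigr => i _; rewrite coefZ scalerA.
Qed.

Lemma cpolyC k T x : cpoly k%:P T x = k *: x.
Proof. by rewrite (@cpolyE 1) ?size_polyC_leq1// big_ord_recl big_ord0 addr0 coefC. Qed.

Lemma cpolyMX P T x : cpoly (P * 'X) T x = cpoly P T (T x).
Proof.
rewrite (@cpolyE (size P).+1); last first.
  by apply: leq_trans (size_polyMleq _ _) _; rewrite size_polyX addn2.
rewrite big_ord_recl coefMX/= scale0r add0r; apply: eq_bigr => i _.
by rewrite coefMX /= -iterS iterSr.
Qed.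

Lemma cpolyX T x : cpoly 'X T x = T x.
Proof. by rewrite -['X]mul1r cpolyMX -[1]/(1%:P) cpolyC scale1r. Qed.

Lemma cpoly_comm P T x : linear T -> cpoly P T (T x) = T (cpoly P T x).
Proof.
move=> lT; rewrite /cpoly (big_morph T (linmapD lT) (linmap0 lT)).
by apply: eq_bigr => i _; rewrite (linmapZ lT) -iterS iterSr.
Qed.

Lemma cpolyM P Q T x : linear T -> cpoly (P * Q) T x = cpoly P T (cpoly Q T x).
Proof.
move=> lT; elim/poly_ind: P x => [|P k IH] x.
  by rewrite mul0r -[0]/(0%:P) !cpolyC !scale0r.
rewrite mulrDl mulrAC !cpolyD !cpolyMX mul_polyC cpolyZ cpolyC IH.
by rewrite cpoly_comm.
Qed.

Lemma cpoly_bounded P T : bounded_operator T -> bounded_operator (cpoly P T).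
Proof.
move=> bT; elim/poly_ind: P => [|P k IH].
  rewrite (_ : cpoly _ _ = 0 *: idfun); first exact/boundedZ/bounded_id.
  by apply/funext => x; rewrite -[0]/(0%:P) cpolyC.
rewrite (_ : cpoly _ _ = (cpoly P T \o T) + k *: idfun).
  by apply: boundedD; [exact: bounded_comp|exact/boundedZ/bounded_id].
by apply/funext => x; rewrite cpolyD cpolyMX cpolyC.
Qed.

Lemma cpoly_comp P Q T x : linear T -> cpoly (P \Po Q) T x = cpoly P (cpoly Q T) x.
Proof.
move=> lT; elim/poly_ind: P x => [|P k IH] x.
  by rewrite comp_poly0 -[0]/(0%:P) !cpolyC !scale0r.
by rewrite comp_poly_MXaddC !cpolyD cpolyMX !cpolyC cpolyM// IH.
Qed.

Lemma poly_operatorE p T : poly_operator p T = cpoly (map_poly (real_complex R) p) T.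
Proof.
apply/funext => x; rewrite /poly_operator fct_sumE /cpoly size_map_poly.
by apply: eq_bigr => i _; rewrite coef_map.
Qed.

(** [X - k] divides [P - P(k)] and the two factors commute at [T], so an inverse of [P(T) - P(k)]
    would yield one of [T - k]. *)
Lemma spectrum_poly T (k : R[i]) P : bounded_operator T -> spectrum T k ->
  spectrum (cpoly P T) P.[k].
Proof.
move=> bT kT inv; apply: kT.
have /factor_theorem[Q QE] : root (P - P.[k]%:P) k by rewrite rootE !hornerE subrr.
have E : cpoly P T - P.[k] *: idfun = cpoly Q T \o (T - k *: idfun).
  apply/funext => x /=; rewrite !fctE.
  transitivity (cpoly (P - P.[k]%:P) T x).
    by rewrite cpolyD -polyCN cpolyC scaleNr.
  rewrite QE cpolyM; last exact: bT.1.
  by rewrite cpolyD -polyCN cpolyC scaleNr cpolyX.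
rewrite -/(invertible_operator _) E in inv; apply: invertible_factor inv.
  exact: cpoly_bounded.
apply/funext => x /=; rewrite !fctE.
have lQ := (cpoly_bounded Q bT).1.
by rewrite (linmapB lQ) (linmapZ lQ) (cpoly_comm _ _ bT.1).
Qed.

(** Split [P - m] into linear factors: if no root were in the spectrum, [P(T) - m] would be a
    product of invertible operators. *)
Lemma spectrum_poly_inv T (m : R[i]) P : bounded_operator T -> spectrum T !=set0 ->
  spectrum (cpoly P T) m -> exists2 k, spectrum T k & P.[k] = m.
Proof.
move=> bT [k0 k0T] mP; apply: contrapT => nk.
have inv k : root (P - m%:P) k -> invertible_operator (T - k *: idfun).
  rewrite rootE !hornerE subr_eq0 => /eqP kP; apply: contrapT => h.
  by apply: nk; exists k.
have [rs rsE] := closed_field_poly_normal (P - m%:P).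
(* When [P] is the constant [m] every number is a root, and any point of the spectrum of [T] gives
   the contradiction. *)
have [l0|l0] := eqVneq (lead_coef (P - m%:P)) 0.
  by apply: k0T; apply: inv; move/eqP: l0; rewrite lead_coef_eq0 => /eqP->; rewrite root0.
apply: mP; rewrite -/(invertible_operator _).
have -> : cpoly P T - m *: idfun =
    (lead_coef (P - m%:P) *: idfun) \o cpoly (\prod_(z <- rs) ('X - z%:P)) T.
  apply/funext => x /=; rewrite !fctE -cpolyZ -rsE.
  by rewrite cpolyD -polyCN cpolyC scaleNr.
apply: invertible_comp; first exact: invertible_scale.
have {inv} : forall k, k \in rs -> invertible_operator (T - k *: idfun).
  by move=> k krs; apply: inv; rewrite rsE rootZ// root_prod_XsubC.
elim: rs {rsE} => [|k rs IH] inv.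
  rewrite big_nil; exists idfun; rewrite /= (_ : cpoly _ _ = idfun).
    by split=> //; exact: bounded_id.
  by apply/funext => x; rewrite -[1]/(1%:P) cpolyC scale1r.
rewrite big_cons (_ : cpoly _ _ =
  (T - k *: idfun) \o cpoly (\prod_(j <- rs) ('X - j%:P)) T).
  apply: invertible_comp; first by apply: inv; rewrite mem_head.
  by apply: IH => j jrs; apply: inv; rewrite inE jrs orbT.
apply/funext => x; rewrite cpolyM; last exact: bT.1.
by rewrite cpolyD -polyCN cpolyC scaleNr cpolyX.
Qed.

End BoundedOperatorAlgebra.

(** * Spectra of symmetric operators *)

Section SelfadjointOperators.
Context {R : realType} {H : completeNormedModType R[i]}.
Variable dot : {dot H for (@conjC R[i])}.
Hypothesis norm_dot : forall x : H, `|x| ^+ 2 = dot x x.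
Implicit Types (x y z : H) (S T A B : H -> H) (p q : {poly R}).
Local Notation rdot := (rdot dot).

Definition symmetric_operator T := forall x y, dot (T x) y = dot x (T y).

Lemma rdot_symmetric T x y : symmetric_operator T -> rdot (T x) y = rdot x (T y).
Proof. by move=> sT; congr complex.Re; exact: sT. Qed.

Lemma symmetric_id : symmetric_operator idfun.
Proof. by []. Qed.

Lemma symmetricD S T : symmetric_operator S -> symmetric_operator T ->
  symmetric_operator (S + T).
Proof. by move=> sS sT x y; rewrite !fctE linearDl linearDr /= sS sT. Qed.

Lemma dotZr_real (r : R) x y : dot x (r%:C *: y) = r%:C * dot x y.
Proof. by rewrite (dotC dot) linearZl_LR rmorphM/= -(dotC dot) oppr0. Qed.

Lemma symmetricZ (r : R) T : symmetric_operator T -> symmetric_operator (r%:C *: T).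
Proof. by move=> sT x y; rewrite !fctE linearZl_LR dotZr_real/= sT. Qed.

Lemma symmetricB_scale (r : R) T : symmetric_operator T ->
  symmetric_operator (T - r%:C *: idfun).
Proof.
move=> sT; rewrite -scaleNr -rmorphN; apply: symmetricD => //.
exact/symmetricZ/symmetric_id.
Qed.

Lemma symmetric_poly p T : symmetric_operator T -> symmetric_operator (poly_operator p T).
Proof.
move=> sT x y; rewrite poly_operatorE /cpoly linear_sumlz linear_sumr.
apply: eq_bigr => i _.
have -> : (map_poly (real_complex R) p)`_i = (p`_i)%:C by rewrite coef_map.
rewrite linearZl_LR; symmetry; apply: etrans (dotZr_real _ _ _) _.
congr (_ * _); symmetry.
by elim: {i}(i : nat) x y => //= n IH x y; rewrite sT IH -iterSr.
Qed.

Lemma poly_operator_bounded p T : bounded_operator T -> bounded_operator (poly_operator p T).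
Proof. by move=> bT; rewrite poly_operatorE; exact: cpoly_bounded. Qed.

(** Surjectivity is [coercive_riesz] for the functional [(., y)]. Coercivity gives injectivity and,
    with Cauchy-Schwarz, the bound [c^-1] on the inverse. *)
Lemma coercive_invertible S (c : R) : bounded_operator S -> symmetric_operator S ->
  0 < c -> (forall x, c * rnorm x ^+ 2 <= rdot (S x) x) -> invertible_operator S.
Proof.
move=> bS sS c0 cS.
have inj x : S x = 0 -> x = 0.
  move=> Sx; apply/eqP; rewrite -rnorm_eq0 -sqrf_eq0 eq_le sqr_ge0 andbT.
  rewrite -(ler_pM2l c0) mulr0; apply: le_trans (cS x) _.
  by rewrite Sx rdot0l.
have /boolp.choice[V VP] : forall y, exists z, S z = y.
  move=> y; have := @coercive_riesz _ _ _ norm_dot S (fun x => dot x y)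
    (opnorm S) (rnorm y) c bS.1 _ sS c0 cS.
  case=> [x|k u v|x|z zP]; first exact: opnorm_ge.
  - by rewrite linearDl linearZl_LR.
  - by rewrite mulrC; exact: dot_le.
  - by exists z; apply: (dot_inj (dot := dot)) => x; rewrite zP.
have SK : S \o V = idfun by apply/funext => x; exact: VP.
have KS x : V (S x) = x.
  by apply/subr0_eq/inj; rewrite (linmapB bS.1) VP subrr.
exists V; split=> //; last exact/funext.
apply: bounded_opnorm => [k u v|].
  by rewrite -[RHS]KS bS.1 !VP.
exists c^-1 => y; rewrite mulrC ler_pdivlMr//.
have [Vy0|Vy0] := eqVneq (rnorm (V y)) 0; first by rewrite Vy0 mul0r rnorm_ge0.
have Vyp : 0 < rnorm (V y) by rewrite lt_def Vy0 rnorm_ge0.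
rewrite -(ler_pM2r Vyp) -mulrA mulrCA -expr2; apply: le_trans (cS _) _.
by rewrite VP; apply: le_trans (ler_norm _) _; exact: rdot_le.
Qed.

(* With [Q = T - Re k] and [k'] the conjugate of [k], [(T - k) (T - k') = Q ^ 2 + (Im k) ^ 2]
   is coercive. *)
Lemma spectrum_symmetric_real T (k : R[i]) : bounded_operator T -> symmetric_operator T ->
  spectrum T k -> k = (complex.Re k)%:C.
Proof.
move=> bT sT; case: k => a b kT; have [-> //|b0] := eqVneq b 0; exfalso; apply: kT.
have [Q [bQ sQ kE]] : exists Q, [/\ bounded_operator Q, symmetric_operator Q &
    forall (t : R) y, (T - (a +i* t) *: idfun) y = Q y - (0 +i* t) *: y].
  exists (T - a%:C *: idfun); split.
  - by apply: boundedB => //; exact/boundedZ/bounded_id.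
  - exact: symmetricB_scale.
  - move=> t y; rewrite !fctE/= -addrA -opprD -scalerDl; congr (_ - _ *: _).
    by apply/eqP; rewrite eq_complex /= addr0 add0r !eqxx.
have lQ := bQ.1.
have TE (s : R) : (T - (a +i* s) *: idfun) \o (T - (a +i* (- s)) *: idfun) =
    (Q \o Q) + (s ^+ 2)%:C *: idfun.
  apply/funext => x; rewrite [LHS]/= !kE (linmapB lQ) (linmapZ lQ) scalerBr scalerA.
  have -> : (0 +i* s) * (0 +i* (- s)) = (s ^+ 2)%:C :> R[i].
    by apply/eqP; rewrite eq_complex /= !(mul0r, mulr0) sub0r mulrN opprK addr0 expr2 !eqxx.
  have -> : 0 +i* (- s) = - (0 +i* s) :> R[i] by apply/eqP; rewrite eq_complex /= oppr0 !eqxx.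
  by rewrite !fctE/= !scaleNr !opprK opprB addrA addrAC addrK addrC.
apply: (@invertible_factor _ _ (T - (a +i* (- b)) *: idfun)).
- by apply: boundedB => //; exact/boundedZ/bounded_id.
- by have := TE (- b); rewrite opprK sqrrN -TE.
have := TE (- b); rewrite opprK => ->.
apply: (@coercive_invertible _ (b ^+ 2)).
- by apply: boundedD; [exact: bounded_comp|exact/boundedZ/bounded_id].
- apply: symmetricD; last exact/symmetricZ/symmetric_id.
  by move=> x y /=; rewrite sQ sQ.
- by rewrite exprn_even_gt0.
move=> x; rewrite !fctE/= (rdotDl dot) (rdotZl dot) (rdotxx norm_dot) sqrrN.
by rewrite lerDr (rdot_symmetric _ _ sQ) (rdotxx norm_dot) sqr_ge0.
Qed.

Lemma spectrum_symmetric_ge T (m r : R) : bounded_operator T -> symmetric_operator T ->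
  (forall x, m * rnorm x ^+ 2 <= rdot (T x) x) -> real_spectrum T r -> m <= r.
Proof.
move=> bT sT mT rT; rewrite leNgt; apply/negP => rm; apply: rT.
apply: (@coercive_invertible _ (m - r)).
- by apply: boundedB => //; exact/boundedZ/bounded_id.
- exact: symmetricB_scale.
- by rewrite subr_gt0.
move=> x; rewrite !fctE/= (rdotBl dot) (rdotZl dot) (rdotxx norm_dot).
by rewrite mulrBl lerD2r.
Qed.

Lemma spectrum_symmetric_le T (m r : R) : bounded_operator T -> symmetric_operator T ->
  (forall x, rdot (T x) x <= m * rnorm x ^+ 2) -> real_spectrum T r -> r <= m.
Proof.
move=> bT sT mT rT; rewrite leNgt; apply/negP => rm; apply: rT.
rewrite -/(invertible_operator _).
have bTr : bounded_operator (T - r%:C *: idfun).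
  by apply: boundedB => //; exact/boundedZ/bounded_id.
(* For [r] above [m] it is the opposite of [T - r] that is coercive, with constant [r - m]. *)
apply: (@invertible_factor _ _ ((-1)%:C *: idfun)).
- exact/boundedZ/bounded_id.
- by apply/funext => x; exact: esym (linmapZ bTr.1 _ _).
apply: (@coercive_invertible _ (r - m)).
- by apply: bounded_comp => //; exact/boundedZ/bounded_id.
- have sTr := symmetricB_scale r sT; exact: (symmetricZ (-1) sTr).
- by rewrite subr_gt0.
move=> x; rewrite /= !fctE/= (rdotZl dot) (rdotBl dot) (rdotZl dot) (rdotxx norm_dot).
by have := mT x; lra.
Qed.

Lemma rdot_opnorm_le T x : bounded_operator T -> `|rdot (T x) x| <= opnorm T * rnorm x ^+ 2.
Proof.
move=> bT; apply: le_trans (rdot_le norm_dot _ _) _.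
by rewrite expr2 mulrA ler_wpM2r ?rnorm_ge0// opnorm_ge.
Qed.

Lemma spectrum_symmetric_norm T (r : R) : bounded_operator T -> symmetric_operator T ->
  real_spectrum T r -> `|r| <= opnorm T.
Proof.
move=> bT sT rT; rewrite ler_norml; apply/andP; split.
  apply: (spectrum_symmetric_ge bT sT _ rT) => x.
  by have := rdot_opnorm_le x bT; rewrite ler_norml mulNr => /andP[].
apply: (spectrum_symmetric_le bT sT _ rT) => x.
by have := rdot_opnorm_le x bT; rewrite ler_norml => /andP[].
Qed.

Hypothesis H_neq0 : exists x : H, x != 0.

(* Put [s = opnorm T].  If [T - s] and [T + s] were invertible, [T ^ 2 - s ^ 2] would be
   bounded below, whereas [|(T ^ 2 - s ^ 2) x| ^ 2 <= 2 s ^ 4 |x| ^ 2 - 2 s ^ 2 |T x| ^ 2]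
   is arbitrarily small on unit vectors. *)
Lemma opnorm_spectrum T : bounded_operator T -> symmetric_operator T ->
  exists2 r, real_spectrum T r & `|r| = opnorm T.
Proof.
move=> bT sT; set s := opnorm T; have s0 : 0 <= s by exact: opnorm_ge0.
apply: contrapT => ns.
have inv r : `|r| = s -> invertible_operator (T - r%:C *: idfun).
  by move=> rs; apply: contrapT => h; apply: ns; exists r.
have := invertible_comp (inv s (ger0_norm s0)) (inv (- s) _).
rewrite normrN ger0_norm// => /(_ erefl)[V [bV VK _]].
have [x0 x0N] := H_neq0.
have nx0 : 0 < rnorm x0 by rewrite lt_def rnorm_eq0 x0N rnorm_ge0.
pose K := opnorm V; have K0 : 0 <= K by exact: opnorm_ge0.
have key x : rnorm x ^+ 2 <=
    K ^+ 2 * (2 * s ^+ 4 * rnorm x ^+ 2 - 2 * s ^+ 2 * rnorm (T x) ^+ 2).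
  have : rnorm x <= K * rnorm (T (T x) - (s ^+ 2)%:C *: x).
    have -> : T (T x) - (s ^+ 2)%:C *: x =
        ((T - s%:C *: idfun) \o (T - (- s)%:C *: idfun)) x.
      rewrite /= !fctE/= rmorphN scaleNr opprK (linmapD bT.1) (linmapZ bT.1).
      by rewrite scalerDr scalerA -rmorphM -expr2 opprD addrA addrK.
    by apply: le_trans (opnorm_ge _ bV); rewrite -[V _]/((V \o (_ \o _)) x) VK.
  rewrite -ler_sqr ?nnegrE ?mulr_ge0 ?rnorm_ge0// exprMn => /le_trans; apply.
  apply: ler_wpM2l; first exact: sqr_ge0.
  rewrite -(rdotxx norm_dot (_ - _)) (rdotBl dot) !(rdotBr dot) !(rdotZl dot) !(rdotZr dot).
  rewrite !(rdotxx norm_dot).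
  have -> : rdot (T (T x)) x = rnorm (T x) ^+ 2 by rewrite rdot_symmetric// rdotxx.
  have -> : rdot x (T (T x)) = rnorm (T x) ^+ 2 by rewrite -rdot_symmetric// rdotxx.
  have : rnorm (T (T x)) ^+ 2 <= s ^+ 2 * rnorm (T x) ^+ 2.
    by rewrite -exprMn ler_sqr ?nnegrE ?mulr_ge0 ?rnorm_ge0// opnorm_ge.
  have : rnorm (T x) ^+ 2 <= s ^+ 2 * rnorm x ^+ 2.
    by rewrite -exprMn ler_sqr ?nnegrE ?mulr_ge0 ?rnorm_ge0// opnorm_ge.
  have -> : s ^+ 4 = s ^+ 2 * s ^+ 2 by rewrite -exprD.
  have := sqr_ge0 s; move: (s ^+ 2) (rnorm (T x) ^+ 2) (rnorm x ^+ 2) (rnorm (T (T x)) ^+ 2).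
  by move=> a b c d; nra.
have Ks : 0 < K ^+ 2 * s ^+ 2.
  rewrite lt_def mulr_ge0 ?sqr_ge0// andbT; apply/negP => /eqP Ks0.
  have := key x0; rewrite (_ : _ * (_ - _) = K ^+ 2 * s ^+ 2 *
    (2 * s ^+ 2 * rnorm x0 ^+ 2 - 2 * rnorm (T x0) ^+ 2)); last by ring.
  by rewrite Ks0 mul0r leNgt exprn_gt0.
(* This comes from solving [key] for [rnorm (T x) ^+ 2]. As [c2 < s ^+ 2], the bound [Num.sqrt c2]
   for [T] contradicts that [s] is its norm. *)
pose c2 := s ^+ 2 - (2 * (K ^+ 2 * s ^+ 2))^-1.
have keyc x : rnorm (T x) ^+ 2 <= c2 * rnorm x ^+ 2.
  rewrite -(ler_pM2l Ks); have := key x.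
  have -> : K ^+ 2 * s ^+ 2 * (c2 * rnorm x ^+ 2) =
      K ^+ 2 * s ^+ 4 * rnorm x ^+ 2 - rnorm x ^+ 2 / 2.
    rewrite /c2; field; move: Ks; rewrite -exprMn => /lt0r_neq0.
    by rewrite expf_eq0/= mulf_eq0 negb_or => /andP[-> ->].
  by lra.
have c20 : 0 <= c2.
  have := le_trans (sqr_ge0 _) (keyc x0).
  by rewrite pmulr_lge0// exprn_gt0.
have : s <= Num.sqrt c2.
  apply: opnorm_le => [|x]; first exact: sqrtr_ge0.
  rewrite -ler_sqr ?nnegrE ?mulr_ge0 ?sqrtr_ge0 ?rnorm_ge0//.
  by rewrite exprMn sqr_sqrtr.
rewrite -ler_sqr ?nnegrE ?sqrtr_ge0// sqr_sqrtr// /c2 lerBDr -subr_ge0.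
have : 0 < (2 * (K ^+ 2 * s ^+ 2))^-1 by rewrite invr_gt0 mulr_gt0.
by lra.
Qed.

Lemma spectrum_neq0 T : bounded_operator T -> symmetric_operator T ->
  spectrum T !=set0.
Proof. by move=> bT sT; have [r rT _] := opnorm_spectrum bT sT; exists r%:C. Qed.

Lemma horner_real_complex p (r : R) :
  (map_poly (real_complex R) p).[r%:C] = (p.[r])%:C.
Proof. exact: horner_map. Qed.

Lemma real_spectrum_poly p T r : bounded_operator T -> real_spectrum T r ->
  real_spectrum (poly_operator p T) p.[r].
Proof.
move=> bT rT; rewrite /real_spectrum/= poly_operatorE -horner_real_complex.
exact: spectrum_poly.
Qed.

Lemma opnorm_poly_ge p T r : bounded_operator T -> symmetric_operator T ->
  real_spectrum T r -> `|p.[r]| <= opnorm (poly_operator p T).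
Proof.
move=> bT sT rT; apply: spectrum_symmetric_norm.
- exact: poly_operator_bounded.
- exact: symmetric_poly.
- exact: real_spectrum_poly.
Qed.

(** The norm of the symmetric operator [p(T)] is the modulus of one of its spectral values, and
    these are the [p.[k]] with [k] in the real spectrum of [T]. This turns uniform approximation on
    the spectrum into approximation in norm. *)
Lemma opnorm_poly_le p T (c : R) : bounded_operator T -> symmetric_operator T ->
  (forall r, real_spectrum T r -> `|p.[r]| <= c) -> opnorm (poly_operator p T) <= c.
Proof.
move=> bT sT pc.
have [r rp <-] := opnorm_spectrum (poly_operator_bounded p bT) (symmetric_poly p sT).
have [] := @spectrum_poly_inv _ _ T r%:C (map_poly (real_complex R) p) bT _ _.
- exact: spectrum_neq0.
- by rewrite -poly_operatorE.
move=> k kT; rewrite (spectrum_symmetric_real bT sT kT) horner_real_complex.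
move=> /complexI <-; apply: pc; rewrite /real_spectrum/=.
by rewrite -(spectrum_symmetric_real bT sT kT).
Qed.

End SelfadjointOperators.

(** * Functional calculus *)

Section UniformConvergence.
Context {R : realType}.
Implicit Types (A : set R) (f : R -> R).

Lemma uniform_cvg_distP A (u : nat -> R -> R) f :
  {uniform A, u @ \oo --> f} <->
  forall e : R, 0 < e -> exists N, forall n, (N <= n)%N ->
    forall r, A r -> `|u n r - f r| < e.
Proof.
split=> [uf e e0|uf P /uniform_nbhs[E [entE EP]]].
  have /uf[N _ NP] : nbhs (f : {uniform` A -> R}) [set h | forall r, A r -> `|f r - h r| < e].
    apply/uniform_nbhs; exists [set xy | ball xy.1 e xy.2]; split=> //.
    by rewrite -entourage_ballE; exists e.
  by exists N => n /NP h r Ar; rewrite distrC; exact: h.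
move: entE; rewrite -entourage_ballE => -[e /= e0 eE].
have [N NP] := uf _ e0; exists N => // n /= Nn; apply: EP => r Ar; apply: eE.
by rewrite /ball/= distrC; exact: NP.
Qed.

End UniformConvergence.

Lemma subr_split3 (V : zmodType) (a b c v w : V) :
  a - (b + c) = (a - (v + w)) + (v - b) + (w - c).
Proof.
symmetry; rewrite opprD (addrA a) (addrAC a) subrKA (addrAC a) subrKA.
by rewrite opprD addrA.
Qed.

Section OperatorCompleteness.
Context {R : realType} {H : completeNormedModType R[i]}.
Implicit Types (x y z : H) (S T A B : H -> H).

Lemma rnorm_eq0_small x (K : R) : (forall e : R, 0 < e -> rnorm x <= e * K) -> x = 0.
Proof.
move=> xK; apply/eqP; rewrite -rnorm_eq0 eq_le rnorm_ge0 andbT.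
apply/ler_addgt0Pr => e e0; rewrite add0r.
have K1 : 0 < `|K| + 1 by rewrite ltr_wpDl.
apply: le_trans (xK (e / (`|K| + 1)) _) _; first by rewrite divr_gt0.
rewrite mulrAC ler_pdivrMr// ler_pM2l//.
by rewrite ltW// (le_lt_trans (ler_norm K))// ltrDl.
Qed.

(** The Cauchy estimate carries the factor [|x|], which survives in the pointwise limit and makes
    the convergence one in norm. *)
Lemma opnorm_complete (u : nat -> H -> H) : (forall n, bounded_operator (u n)) ->
  (forall e : R, 0 < e -> exists N, forall m n, (N <= m)%N -> (N <= n)%N ->
     opnorm (u m - u n) <= e) ->
  exists2 B, bounded_operator B &
    forall e : R, 0 < e -> exists N, forall n, (N <= n)%N -> opnorm (u n - B) <= e.
Proof.
move=> bu uC.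
have ux e : 0 < e -> exists N, forall m n, (N <= m)%N -> (N <= n)%N ->
    forall x, rnorm (u m x - u n x) <= e * rnorm x.
  move=> e0; have [N NP] := uC _ e0; exists N => m n Nm Nn x.
  have := opnorm_ge x (boundedB (bu m) (bu n)); rewrite fctE => /le_trans; apply.
  by apply: ler_wpM2r; [exact: rnorm_ge0|exact: NP].
have /boolp.choice[B BP] : forall x, exists z, forall e : R, 0 < e ->
    exists N, forall n, (N <= n)%N -> rnorm (u n x - z) < e.
  move=> x; apply: rnorm_complete => e e0.
  have x1 : 0 < rnorm x + 1 by rewrite ltr_wpDl ?rnorm_ge0.
  have [|N NP] := ux (e / (rnorm x + 1)); first by rewrite divr_gt0.
  exists N => m n Nm Nn; apply: le_lt_trans (NP _ _ Nm Nn _) _.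
  by rewrite mulrAC ltr_pdivrMr// ltr_pM2l// ltrDl.
have Bu e : 0 < e -> exists N, forall n, (N <= n)%N -> forall x,
    rnorm (u n x - B x) <= e * rnorm x.
  move=> e0; have [N NP] := ux _ e0; exists N => n Nn x.
  apply/ler_addgt0Pr => d d0; have [M MP] := BP x _ d0.
  apply: le_trans (rnorm_tri (u (maxn N M) x) _ _) _.
  by rewrite lerD ?NP ?leq_maxl// ltW// MP// leq_maxr.
have lB : linear B.
  move=> k x y; apply/subr0_eq.
  apply: (@rnorm_eq0_small _ (rnorm (k *: x + y) + rnorm k * rnorm x + rnorm y)) => e e0.
  have [N NP] := Bu _ e0.
  have -> : B (k *: x + y) - (k *: B x + B y) =
      (B (k *: x + y) - u N (k *: x + y)) + k *: (u N x - B x) + (u N y - B y).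
    by rewrite (bu N).1 scalerBr -subr_split3.
  rewrite !mulrDr; apply: le_trans (rnormD _ _) _; apply: lerD; last exact: NP.
  apply: le_trans (rnormD _ _) _; apply: lerD; first by rewrite rnormB NP.
  by rewrite rnormZ mulrCA ler_wpM2l ?rnormC_ge0// NP.
have bB : bounded_operator B.
  apply: bounded_opnorm => //; have [N NP] := Bu 1 ltr01.
  exists (opnorm (u N) + 1) => x; rewrite mulrDl -[B x]subr0 -(subrr (u N x)) opprB.
  rewrite addrCA; apply: le_trans (rnormD _ _) _; apply: lerD; first exact: opnorm_ge.
  by rewrite rnormB NP.
exists B => // e e0; have [N NP] := Bu _ e0; exists N => n Nn.
by apply: opnorm_le => [|x]; [exact: ltW|rewrite fctE; exact: NP].
Qed.

End OperatorCompleteness.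

Section PolyOperator.
Context {R : realType} {H : completeNormedModType R[i]}.
Implicit Types (x y z : H) (S T A B : H -> H) (p q : {poly R}).

Lemma poly_operatorD p q T : poly_operator (p + q) T = poly_operator p T + poly_operator q T.
Proof. by apply/funext => x; rewrite !poly_operatorE rmorphD cpolyD. Qed.

Lemma poly_operatorZ (r : R) p T : poly_operator (r *: p) T = r%:C *: poly_operator p T.
Proof.
by apply/funext => x; rewrite !poly_operatorE map_polyZ cpolyZ.
Qed.

Lemma poly_operatorB p q T : poly_operator (p - q) T = poly_operator p T - poly_operator q T.
Proof.
rewrite poly_operatorD -scaleN1r poly_operatorZ; congr (_ + _).
by rewrite rmorphN1 scaleN1r.
Qed.

Lemma poly_operatorM p q T : linear T ->
  poly_operator (p * q) T = poly_operator p T \o poly_operator q T.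
Proof.
by move=> lT; apply/funext => x; rewrite /= !poly_operatorE rmorphM/= cpolyM.
Qed.

Lemma poly_operator_comp p q T : linear T ->
  poly_operator (p \Po q) T = poly_operator p (poly_operator q T).
Proof.
by move=> lT; apply/funext => x; rewrite !poly_operatorE map_comp_poly cpoly_comp.
Qed.

Lemma poly_operatorX T : poly_operator 'X T = T.
Proof. by apply/funext => x; rewrite poly_operatorE map_polyX cpolyX. Qed.

Lemma poly_operatorC (r : R) T : poly_operator r%:P T = r%:C *: idfun.
Proof. by apply/funext => x; rewrite poly_operatorE map_polyC cpolyC. Qed.

End PolyOperator.

Section FunctionalCalculus.
Context {R : realType} {H : completeNormedModType R[i]}.
Variable dot : {dot H for (@conjC R[i])}.
Hypothesis norm_dot : forall x : H, `|x| ^+ 2 = dot x x.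
Hypothesis H_neq0 : exists x : H, x != 0.
Implicit Types (x y z : H) (S T A B C : H -> H) (p q : {poly R}) (f g : R -> R).

(** Trades the sequence of polynomials for one polynomial per [e] that is good on the spectrum and
    in norm; conversely the sequence is chosen with errors [1 / (n + 1)]. *)
Lemma is_funcalcP f T B : bounded_operator T -> is_funcalc f T B <-> bounded_operator B /\
  forall e : R, 0 < e -> exists2 p, forall r, real_spectrum T r -> `|p.[r] - f r| <= e &
    opnorm (poly_operator p T - B) <= e.
Proof.
move=> bT; split=> [[bB [p pf pB]]|[bB fB]]; split=> //.
  move=> e e0; have [N NP] := (uniform_cvg_distP _ _ _).1 pf _ e0.
  have /cvgrPdist_lt/(_ _ e0)[M _ MP] := pB.
  exists (p (maxn N M)) => [r rT|]; first by rewrite ltW// NP// leq_maxl.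
  have := MP (maxn N M) (leq_maxr _ _); rewrite /= sub0r normrN => /ltW.
  exact/le_trans/ler_norm.
have /boolp.choice[p pP] : forall n : nat, exists p,
    (forall r, real_spectrum T r -> `|p.[r] - f r| <= n.+1%:R^-1) /\
    opnorm (poly_operator p T - B) <= n.+1%:R^-1.
  by move=> n; have [|p p1 p2] := fB n.+1%:R^-1; [rewrite invr_gt0 ltr0n|exists p].
exists p.
  apply/uniform_cvg_distP => e /eventually_invSn_lt[N NP]; exists N => n Nn r rT.
  exact: le_lt_trans ((pP n).1 r rT) (NP _ Nn).
apply/cvgrPdist_lt => e /eventually_invSn_lt[N NP]; exists N => // n /= Nn.
rewrite sub0r normrN ger0_norm.
  exact: le_lt_trans (pP n).2 (NP _ Nn).
by apply/opnorm_ge0/boundedB => //; exact: poly_operator_bounded.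
Qed.

Section FixedOperator.
Variable T : H -> H.
Hypotheses (bT : bounded_operator T) (sT : symmetric_operator dot T).

Lemma opnorm_le_dist S A : bounded_operator S -> bounded_operator A ->
  opnorm A <= opnorm S + opnorm (S - A).
Proof.
move=> bS bA; rewrite -[X in X <= _](_ : opnorm (S - (S - A)) = _).
  by rewrite -(opnormN (S - A)); apply: opnormD => //; exact/boundedN/boundedB.
by rewrite opprB addrC subrK.
Qed.

Lemma funcalc_le f B (c : R) : is_funcalc f T B ->
  (forall r, real_spectrum T r -> `|f r| <= c) -> opnorm B <= c.
Proof.
move=> /(is_funcalcP _ _ bT)[bB fB] fc; apply/ler_addgt0Pr => e e0.
have [|p pf pB] := fB (e / 2); first by rewrite divr_gt0.
apply: le_trans (opnorm_le_dist (poly_operator_bounded p bT) bB) _.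
have : opnorm (poly_operator p T) <= c + e / 2.
  apply: (opnorm_poly_le norm_dot H_neq0 bT sT) => r rT.
  have := pf r rT; have := fc r rT; have := ler_normD (f r) (p.[r] - f r).
  by rewrite subrKC; lra.
by lra.
Qed.

Lemma funcalc_ge f B r : is_funcalc f T B -> real_spectrum T r -> `|f r| <= opnorm B.
Proof.
move=> /(is_funcalcP _ _ bT)[bB fB] rT; apply/ler_addgt0Pr => e e0.
have [|p pf pB] := fB (e / 2); first by rewrite divr_gt0.
have bp := poly_operator_bounded p bT.
have := opnorm_le_dist bB bp; rewrite (opnormB B).
have := pf r rT; have := opnorm_poly_ge norm_dot p bT sT rT.
have := ler_normB p.[r] (p.[r] - f r); rewrite subKr.
by lra.
Qed.

Lemma is_funcalc_poly p : is_funcalc (horner p) T (poly_operator p T).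
Proof.
apply/(is_funcalcP _ _ bT); split=> [|e e0]; first exact: poly_operator_bounded.
exists p => [r _|]; first by rewrite subrr normr0 ltW.
rewrite subrr; apply: opnorm_le => [|x]; first exact: ltW.
by change (rnorm (0 : H) <= e * rnorm x); rewrite rnorm0 mulr_ge0 ?rnorm_ge0// ltW.
Qed.

Lemma is_funcalc_ext f g B : (forall r, real_spectrum T r -> f r = g r) ->
  is_funcalc f T B -> is_funcalc g T B.
Proof.
move=> fg /(is_funcalcP _ _ bT)[bB fB]; apply/(is_funcalcP _ _ bT); split=> // e /fB[p pf pB].
by exists p => // r rT; rewrite -fg//; exact: pf.
Qed.

Lemma is_funcalcD f g B C : is_funcalc f T B -> is_funcalc g T C ->
  is_funcalc (f \+ g) T (B + C).
Proof.
move=> /(is_funcalcP _ _ bT)[bB fB] /(is_funcalcP _ _ bT)[bC gC].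
apply/(is_funcalcP _ _ bT); split=> [|e e0]; first exact: boundedD.
have [|p pf pB] := fB (e / 2); first by rewrite divr_gt0.
have [|q qg qC] := gC (e / 2); first by rewrite divr_gt0.
exists (p + q) => [r rT|].
  rewrite hornerD /= opprD addrACA; apply: le_trans (ler_normD _ _) _.
  by have := pf r rT; have := qg r rT; lra.
have bp := poly_operator_bounded p bT; have bq := poly_operator_bounded q bT.
rewrite poly_operatorD opprD addrACA.
by apply: le_trans (opnormD (boundedB bp bB) (boundedB bq bC)) _; lra.
Qed.

Lemma is_funcalcZ (k : R) f B : is_funcalc f T B ->
  is_funcalc (fun r => k * f r) T (k%:C *: B).
Proof.
move=> /(is_funcalcP _ _ bT)[bB fB].
apply/(is_funcalcP _ _ bT); split=> [|e e0]; first exact: boundedZ.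
have k1 : 0 < `|k| + 1 by rewrite ltr_wpDl.
have ke (x : R) : x <= e / (`|k| + 1) -> `|k| * x <= e.
  move=> xe; apply: le_trans (ler_wpM2l (normr_ge0 k) xe) _.
  by rewrite mulrCA ler_piMr ?ltW// ltr_pdivrMr// mul1r ltrDl.
have [|p pf pB] := fB (e / (`|k| + 1)); first by rewrite divr_gt0.
exists (k *: p) => [r rT|].
  by rewrite hornerZ -mulrBr normrM ke// pf.
rewrite poly_operatorZ -scalerBr.
have bpB := boundedB (poly_operator_bounded p bT) bB.
apply: le_trans (ke _ pB); apply: opnorm_le => [|x].
  by rewrite mulr_ge0 ?opnorm_ge0.
change (rnorm (k%:C *: (poly_operator p T - B) x) <=
  `|k| * opnorm (poly_operator p T - B) * rnorm x).
by rewrite rnormZr -mulrA ler_wpM2l//; exact: opnorm_ge.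
Qed.

Lemma is_funcalc_sum n (a : nat -> R) (f : nat -> R -> R) (F : nat -> H -> H) :
  (forall i, (i < n)%N -> is_funcalc (f i) T (F i)) ->
  is_funcalc (fun r => \sum_(i < n) a i * f i r) T (\sum_(i < n) (a i)%:C *: F i).
Proof.
elim: n => [|n IH] fF.
  rewrite big_ord0 (_ : 0 = poly_operator 0 T).
    apply: is_funcalc_ext (is_funcalc_poly 0) => r _.
    by rewrite big_ord0 hornerC.
  by apply/funext => x; rewrite poly_operatorC rmorph0 scale0r.
rewrite big_ord_recr/=.
apply: is_funcalc_ext (is_funcalcD (IH _) (is_funcalcZ (a n) (fF n _))) => //.
  by move=> r _; rewrite big_ord_recr.
by move=> i ni; apply: fF; exact: ltnW.
Qed.

Lemma is_funcalc_sqr f B : is_funcalc f T B -> is_funcalc (fun r => f r ^+ 2) T (B \o B).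
Proof.
move=> fTB; have := fTB; move=> /(is_funcalcP _ _ bT)[bB fB].
apply/(is_funcalcP _ _ bT); split=> [|e e0]; first exact: bounded_comp.
set M := opnorm B; have M0 : 0 <= M by exact: opnorm_ge0.
have Me : 0 < 2 * M + 1 + e by rewrite ltr_wpDl// addr_ge0// mulr_ge0.
(* Both errors, of [p ^+ 2] on the spectrum and of its operator in norm, are at most [d (2 M + d)];
   as [d <= 1], this choice keeps them below [e]. *)
pose d := e / (2 * M + 1 + e); have d0 : 0 < d by rewrite divr_gt0.
have dE : d * (2 * M + 1 + e) = e by rewrite divfK// lt0r_neq0.
have d1 : d <= 1 by rewrite ler_pdivrMr// mul1r; lra.
have de : d * (2 * M + d) <= e by rewrite -[leRHS]dE ler_pM2l//; lra.
have [p pf pB] := fB d d0.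
exists (p ^+ 2) => [r rT|].
  rewrite horner_exp subr_sqr normrM; apply: le_trans de.
  have fM := funcalc_ge fTB rT; have pfr := pf r rT.
  apply: ler_pM => //; rewrite (_ : _ + _ = (p.[r] - f r) + f r *+ 2); last by ring.
  by apply: le_trans (ler_normD _ _) _; rewrite normrMn; move: fM; rewrite -/M mulr2n; lra.
have bp := poly_operator_bounded p bT; have bd := boundedB bp bB.
rewrite expr2 (poly_operatorM _ _ (bounded_linear bT)).
have -> : (poly_operator p T \o poly_operator p T) - (B \o B) =
    (poly_operator p T \o (poly_operator p T - B)) + ((poly_operator p T - B) \o B).
  by apply/funext => x; rewrite !fctE/= (linmapB bp.1) subrKA.
apply: le_trans (opnormD (bounded_comp bp bd) (bounded_comp bd bB)) _.
have pM : opnorm (poly_operator p T) <= M + d.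
  have := opnorm_le_dist bB bp; rewrite (opnormB B) -/M.
  by move=> /le_trans; apply; rewrite lerD2l.
have := opnorm_comp bp bd; have := opnorm_comp bd bB; rewrite -/M.
have : opnorm (poly_operator p T - B) * M <= d * M by rewrite ler_wpM2r.
have : opnorm (poly_operator p T) * opnorm (poly_operator p T - B) <= (M + d) * d.
  by rewrite ler_pM ?opnorm_ge0.
by lra.
Qed.

(** Spectral mapping sends the spectrum of [T] into that of [q(T)], so composing with [q] keeps the
    approximation. Functions of different polynomials in [T] thus become functions of [T] itself. *)
Lemma is_funcalc_comp_poly f q B : is_funcalc f (poly_operator q T) B ->
  is_funcalc (fun r => f q.[r]) T B.
Proof.
move=> /(is_funcalcP _ _ (poly_operator_bounded q bT))[bB fB].
apply/(is_funcalcP _ _ bT); split=> // e /fB[p pf pB].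
exists (p \Po q) => [r rT|].
  by rewrite horner_comp; apply: pf; exact: real_spectrum_poly.
by rewrite (poly_operator_comp _ _ (bounded_linear bT)).
Qed.

(** The difference represents the zero function, so its norm is at most 0. *)
Lemma is_funcalc_unique f B C : is_funcalc f T B -> is_funcalc f T C -> B = C.
Proof.
move=> fB fC; have fBC := is_funcalcD fB (is_funcalcZ (-1) fC).
have /(opnorm_le0 fBC.1) : opnorm (B + (-1)%:C *: C) <= 0.
  apply: (funcalc_le fBC) => r _.
  by rewrite /= mulN1r subrr normr0.
by rewrite rmorphN1 scaleN1r => /subr0_eq.
Qed.

Lemma funcalcE f B : is_funcalc f T B -> funcalc f T = B.
Proof. by move=> fB; apply: xget_unique => // C fC; exact: (is_funcalc_unique fC fB). Qed.

Lemma is_funcalc_exists f : continuous f -> exists B, is_funcalc f T B.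
Proof.
(* The segment [[- M, M]] contains the spectrum; the [+ 1] keeps it nondegenerate when [T = 0]. *)
move=> cf; pose M := opnorm T + 1; have oT := opnorm_ge0 bT.
have rM r : real_spectrum T r -> - M <= r <= M.
  by move=> /(spectrum_symmetric_norm norm_dot bT sT); rewrite -ler_norml /M; lra.
have /boolp.choice[p pP] : forall n : nat, exists p,
    forall r, - M <= r <= M -> `|p.[r] - f r| <= n.+1%:R^-1.
  by move=> n; apply: weierstrass => //; rewrite /M; lra.
have [||B bB BP] := @opnorm_complete _ _ (fun n => poly_operator (p n) T).
- by move=> n; exact: poly_operator_bounded.
- move=> e e0; have [|N NP] := @eventually_invSn_lt R (e / 2); first by rewrite divr_gt0.
  exists N => m n Nm Nn; rewrite -poly_operatorB.
  apply: (opnorm_poly_le norm_dot H_neq0 bT sT) => r /rM rr; rewrite hornerD hornerN.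
  have := le_trans (pP m r rr) (ltW (NP m Nm)); have := le_trans (pP n r rr) (ltW (NP n Nn)).
  by have := ler_normB ((p m).[r] - f r) ((p n).[r] - f r); rewrite opprB subrKA; lra.
exists B; apply/(is_funcalcP _ _ bT); split=> // e e0.
have [N NP] := BP _ e0; have [M' MP] := eventually_invSn_lt e0.
exists (p (maxn N M')) => [r /rM rr|]; last by apply: NP; rewrite leq_maxl.
by apply: le_trans (pP _ _ rr) _; rewrite ltW// MP// leq_maxr.
Qed.

End FixedOperator.

End FunctionalCalculus.

(** * Adjoints and moduli *)

Section Adjoint.
Context {R : realType} {H : completeNormedModType R[i]}.
Variable dot : {dot H for (@conjC R[i])}.
Hypothesis norm_dot : forall x : H, `|x| ^+ 2 = dot x x.
Implicit Types (x y z : H) (S T A B : H -> H).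
Local Notation rdot := (rdot dot).

Lemma adjoint_exists A : bounded_operator A -> exists B, is_adjoint dot A B.
Proof.
move=> bA.
have /boolp.choice[B BP] : forall y, exists z, forall x, dot (A x) y = dot x z.
  move=> y; apply: (@coercive_riesz _ _ _ norm_dot idfun (fun x => dot (A x) y)
    1 (opnorm A * rnorm y) 1) => //.
  - by move=> x; rewrite mul1r.
  - by move=> x; rewrite mul1r (rdotxx norm_dot).
  - by move=> k u v; rewrite bA.1 linearDl linearZl_LR.
  - move=> x; apply: le_trans (dot_le norm_dot _ _) _.
    by rewrite mulrAC ler_wpM2r ?rnorm_ge0// opnorm_ge.
exists B; split=> //; apply: bounded_opnorm.
  move=> k x y; apply: (dot_inj (dot := dot)) => z.
  by rewrite -BP (dotC dot) linearDl linearZl_LR rmorphD rmorphM/= [dot z _](dotC dot)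
             linearDl linearZl_LR rmorphD rmorphM/= -!(dotC dot) !BP.
exists (opnorm A) => y.
have [By0|By0] := eqVneq (rnorm (B y)) 0.
  by rewrite By0 mulr_ge0 ?opnorm_ge0 ?rnorm_ge0.
have Byp : 0 < rnorm (B y) by rewrite lt_def By0 rnorm_ge0.
rewrite -(ler_pM2r Byp) -expr2 -(rdotxx norm_dot) mulrAC.
have -> : rdot (B y) (B y) = rdot (A (B y)) y by congr complex.Re; rewrite BP.
apply: le_trans (ler_norm _) _; apply: le_trans (rdot_le norm_dot _ _) _.
by rewrite ler_wpM2r ?rnorm_ge0// opnorm_ge.
Qed.

Lemma adjointP A : bounded_operator A -> is_adjoint dot A (adjoint dot A).
Proof. by move=> /adjoint_exists; exact: xgetPex. Qed.

Lemma adjoint_bounded A : bounded_operator A -> bounded_operator (adjoint dot A).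
Proof. by move=> /adjointP[]. Qed.

Lemma gram_bounded A : bounded_operator A -> bounded_operator (adjoint dot A \o A).
Proof. by move=> bA; apply: bounded_comp => //; exact: adjoint_bounded. Qed.

Lemma gram_symmetric A : bounded_operator A -> symmetric_operator dot (adjoint dot A \o A).
Proof.
move=> bA x y /=; rewrite -(adjointP bA).2.
by rewrite (dotC dot) -(adjointP bA).2 -(dotC dot).
Qed.

Lemma rdot_gram A x : bounded_operator A -> rdot ((adjoint dot A \o A) x) x = rnorm (A x) ^+ 2.
Proof.
move=> bA; rewrite rdotC -(rdotxx norm_dot); congr complex.Re.
by rewrite -(adjointP bA).2.
Qed.

Hypothesis H_neq0 : exists x : H, x != 0.

(** Both sides represent functions of [adjoint dot A \o A], the square of the square root and the
    identity. They agree on its spectrum, which is nonnegative, so uniqueness applies. *)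
Lemma op_abs_sqr A : bounded_operator A ->
  op_abs dot A \o op_abs dot A = adjoint dot A \o A.
Proof.
move=> bA; have bT := gram_bounded bA; have sT := gram_symmetric bA.
have [B fB] := is_funcalc_exists norm_dot H_neq0 bT sT (@sqrt_continuous R).
rewrite /op_abs (funcalcE norm_dot H_neq0 bT sT fB).
have := is_funcalc_poly bT 'X; rewrite poly_operatorX.
apply: (is_funcalc_unique norm_dot H_neq0 bT sT).
apply: (is_funcalc_ext bT) (is_funcalc_sqr norm_dot bT sT fB) => r rT.
rewrite hornerX sqr_sqrtr//; apply: (spectrum_symmetric_ge norm_dot bT sT _ rT) => x.
by rewrite mul0r rdot_gram// sqr_ge0.
Qed.

Section ConvexCombination.
Variables (A : H -> H) (alpha : R).
Hypotheses (bA : bounded_operator A) (alpha01 : 0 <= alpha <= 1).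
Let B : H -> H := alpha%:C *: (op_abs dot A \o op_abs dot A) +
  (1 - alpha)%:C *: (op_abs dot (adjoint dot A) \o op_abs dot (adjoint dot A)).

Lemma comb_gramE : B = alpha%:C *: (adjoint dot A \o A) +
  (1 - alpha)%:C *: (adjoint dot (adjoint dot A) \o adjoint dot A).
Proof. by rewrite /B !op_abs_sqr//; exact: adjoint_bounded. Qed.

Lemma comb_bounded : bounded_operator B.
Proof.
rewrite comb_gramE; apply: boundedD; apply: boundedZ; apply: gram_bounded => //.
exact: adjoint_bounded.
Qed.

Lemma comb_symmetric : symmetric_operator dot B.
Proof.
rewrite comb_gramE; apply: symmetricD; apply: symmetricZ; apply: gram_symmetric => //.
exact: adjoint_bounded.
Qed.

Lemma rdot_comb x : rdot (B x) x =
  alpha * rnorm (A x) ^+ 2 + (1 - alpha) * rnorm (adjoint dot A x) ^+ 2.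
Proof.
rewrite comb_gramE; change (rdot (alpha%:C *: (adjoint dot A \o A) x +
  (1 - alpha)%:C *: (adjoint dot (adjoint dot A) \o adjoint dot A) x) x = 
  alpha * rnorm (A x) ^+ 2 + (1 - alpha) * rnorm (adjoint dot A x) ^+ 2).
by rewrite (rdotDl dot) !(rdotZl dot) !rdot_gram//; exact: adjoint_bounded.
Qed.

Lemma rdot_comb_ge0 x : 0 <= rdot (B x) x.
Proof.
case/andP: alpha01 => a0 a1.
by rewrite rdot_comb addr_ge0// mulr_ge0 ?sqr_ge0 ?subr_ge0.
Qed.

Lemma numerical_radius_sqr_le : 0 <= numerical_radius dot A ^+ 2 <= opnorm B.
Proof.
rewrite sqr_ge0 /=.
have bnd x : `|x| = 1 -> rnorm (dot (A x) x) <= Num.sqrt (opnorm B).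
  move=> /(congr1 (@complex.Re R)) /= x1.
  rewrite -ler_sqr ?nnegrE ?sqrtr_ge0 ?rnormC_ge0// sqr_sqrtr ?(opnorm_ge0 comb_bounded)//.
  have h1 : rnorm (dot (A x) x) <= rnorm (A x).
    by have := dot_le norm_dot (A x) x; rewrite x1 mulr1.
  have h2 : rnorm (dot (A x) x) <= rnorm (adjoint dot A x).
    rewrite (adjointP bA).2; have := dot_le norm_dot x (adjoint dot A x).
    by rewrite x1 mul1r.
  have h0 := rnormC_ge0 (dot (A x) x).
  have : rnorm (dot (A x) x) ^+ 2 <= rnorm (A x) ^+ 2 by rewrite ler_sqr ?nnegrE ?rnorm_ge0.
  have : rnorm (dot (A x) x) ^+ 2 <= rnorm (adjoint dot A x) ^+ 2.
    by rewrite ler_sqr ?nnegrE ?rnorm_ge0.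
  have := rdot_opnorm_le norm_dot x comb_bounded.
  rewrite rdot_comb x1 expr1n mulr1 => /(le_trans (ler_norm _)).
  by move: alpha01; move: (rnorm (dot _ _) ^+ 2) (rnorm (A x) ^+ 2) (rnorm _ ^+ 2) => a b c; nra.
have [x0 x00] := H_neq0.
have [x x1] : exists x : H, `|x| = 1.
  have nx0 : 0 < rnorm x0 by rewrite lt_def rnorm_eq0 x00 rnorm_ge0.
  exists ((rnorm x0)^-1%:C *: x0); rewrite normE rnormZr gtr0_norm ?invr_gt0//.
  by rewrite mulVf// lt0r_neq0.
have w_le : numerical_radius dot A <= Num.sqrt (opnorm B).
  by apply: ge_sup => [|_ [y /= y1 <-]]; [exists (rnorm (dot (A x) x)), x|exact: bnd].
(* Comparing squares needs the sign of the supremum; any unit vector supplies it. *)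
have w_ge : 0 <= numerical_radius dot A.
  apply: le_trans (rnormC_ge0 (dot (A x) x)) _; apply: ub_le_sup; last by exists x.
  by exists (Num.sqrt (opnorm B)) => _ [y /= y1 <-]; exact: bnd.
rewrite -[leRHS]sqr_sqrtr ?(opnorm_ge0 comb_bounded)//.
by rewrite ler_sqr ?nnegrE ?sqrtr_ge0.
Qed.

End ConvexCombination.
End Adjoint.

(** * Riemann integrals *)

Section Partitions.
Context {R : realType}.
Implicit Types (a b d : R) (s : seq R) (c : nat -> R).

Lemma tagged_partition_mem a b s c i : tagged_partition a b s c -> (i < size s)%N ->
  [/\ a <= nth b (a :: s) i, nth b (a :: s) i < nth b (a :: s) i.+1,
      nth b (a :: s) i.+1 <= b & nth b (a :: s) i <= c i <= nth b (a :: s) i.+1].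
Proof.
move=> [ps cs] is_; split.
- by apply: itv_partition_nth_ge ps; exact: ltnW.
- by case: ps => /(pathP b)/(_ i is_).
- exact: itv_partition_nth_le ps.
- exact: cs.
Qed.

Lemma sum_telescope_partition a b s (F : R -> R) : itv_partition a b s ->
  \sum_(i < size s) (F (nth b (a :: s) i.+1) - F (nth b (a :: s) i)) = F b - F a.
Proof.
move=> ps; rewrite -(big_mkord xpredT (fun i => F (nth b (a :: s) i.+1) - F (nth b (a :: s) i))).
by rewrite (telescope_sumr (fun i => F (nth b (a :: s) i)))// (itv_partition_nth_size _ ps).
Qed.

(** Equal pieces tagged at their left ends. Without fine partitions every bounded operator would be
    an integral vacuously, so uniqueness of the integral depends on this. *)
Lemma exists_fine_partition d : 0 < d ->
  exists s c, tagged_partition 0 1 s c /\ mesh_lt 0 1 s d.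
Proof.
move=> d0; pose n := truncn d^-1.
have nd : n.+1%:R^-1 < d.
  by rewrite invf_plt ?posrE ?ltr0n//; exact: truncnS_gt.
have n0 : 0 < n.+1%:R :> R by rewrite ltr0n.
pose s : seq R := mkseq (fun i => i.+1%:R / n.+1%:R) n.+1.
have ss : size s = n.+1 by rewrite size_mkseq.
have sE i : (i <= n.+1)%N -> nth 1 (0 :: s) i = i%:R / n.+1%:R.
  by case: i => [|i] ni; rewrite /= ?mul0r// nth_mkseq.
exists s, (fun i => nth 1 (0 :: s) i); split; last first.
  move=> i; rewrite ss => ni; rewrite !sE//; last exact: ltnW.
  by rewrite -mulrBl -natrB// subSnn mul1r.
have lt i : (i < size s)%N -> nth 1 (0 :: s) i < nth 1 (0 :: s) i.+1.
  move=> ni; rewrite ss in ni; rewrite !sE//; last exact: ltnW.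
  by rewrite ltr_pM2r ?invr_gt0// ltr_nat.
split=> [|i /lt ilt]; last by rewrite lexx ltW.
split; first by apply/(pathP 1).
by rewrite (last_nth 1) ss sE// divff// lt0r_neq0.
Qed.

End Partitions.

Section ScalarIntegral.
Context {R : realType}.
Variables (h : R -> R) (w b : R).
Hypotheses (ch : continuous h) (wb : 0 <= w <= b).

Lemma segment_primitive_exists : exists Phi : R -> R -> R, forall x t : R, 0 <= t <= 1 ->
  is_derive t 1 (Phi x) (h ((1 - t) * x + t * w)).
Proof.
suff /boolp.choice[Phi PhiP] : forall x : R, exists F : R -> R, forall t : R,
    0 <= t <= 1 -> is_derive t 1 F (h ((1 - t) * x + t * w)) by exists Phi.
move=> x; apply: continuous_antiderivative ltr01 => t.
apply: (@continuous_comp R R R (fun t : R => (1 - t) * x + t * w) h t); last exact: ch.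
rewrite (_ : (fun t : R => _) = (fun t : R => x + t * (w - x))); first exact: continuous_affine.
by apply/funext => u; ring.
Qed.

Variable Phi : R -> R -> R.
Hypothesis PhiP : forall x t : R, 0 <= t <= 1 -> is_derive t 1 (Phi x) (h ((1 - t) * x + t * w)).

Lemma is_derive_MVT (F f : R -> R) (s t : R) : 0 <= s -> s <= t -> t <= 1 ->
  (forall u : R, 0 <= u <= 1 -> is_derive u 1 F (f u)) ->
  exists2 u : R, s <= u <= t & F t - F s = f u * (t - s).
Proof.
move=> s0 st t1 Ff; have [||u] := @MVT_segment R F f s t st.
- by move=> u; rewrite in_itv/= => ust; apply: Ff; lra.
- apply: derivable_within_continuous => u; rewrite in_itv/= => ust.
  by have [] : is_derive u 1 F (f u) by apply: Ff; lra.
- by rewrite in_itv/=; exists u.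
Qed.

Lemma primitive_mean (x s t : R) : 0 <= s -> s <= t -> t <= 1 ->
  exists2 u : R, s <= u <= t & Phi x t - Phi x s = h ((1 - u) * x + u * w) * (t - s).
Proof.
move=> s0 st t1.
exact: (is_derive_MVT (f := fun u => h ((1 - u) * x + u * w)) s0 st t1 (@PhiP x)).
Qed.

(** This is the integral of [h ((1 - t) * x + t * w)] for [t] from 0 to 1. Written with a primitive,
    it is estimated through the mean value theorem alone. *)
Definition segment_integral x := Phi x 1 - Phi x 0.

Lemma segment_integral_mean x : exists2 u : R, 0 <= u <= 1 &
  segment_integral x = h ((1 - u) * x + u * w).
Proof.
have [u u01 E] := primitive_mean x (lexx 0) ler01 (lexx 1).
by exists u => //; rewrite /segment_integral E subr0 mulr1.
Qed.

(** The mean value theorem is applied to [Phi x - Phi y], so a single [u] serves both points;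
    separate mean values would have unrelated ones. *)
Lemma segment_integral_modulus (x e : R) : 0 < e -> exists2 d : R, 0 < d &
  forall y : R, `|x - y| < d -> `|segment_integral x - segment_integral y| < e.
Proof.
move=> e0; have wb' := wb; pose K : R := `|x| + w.
have [d d0 dP] := segment_unif_continuous (- K) K ch e0; exists d => // y xy.
pose D : R -> R := Phi x - Phi y.
have DP (u : R) : 0 <= u <= 1 -> is_derive u 1 D
    (h ((1 - u) * x + u * w) - h ((1 - u) * y + u * w)).
  by move=> u01; apply: is_deriveB; exact: PhiP.
have [u u01 DE] := is_derive_MVT (lexx 0) ler01 (lexx 1) DP.
have -> : segment_integral x - segment_integral y = D 1 - D 0.
  by rewrite /segment_integral /D !fctE; ring.
rewrite DE subr0 mulr1; apply: dP.
  have : `|(1 - u) * x| <= `|x|.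
    by rewrite normrM ger0_norm ?ler_piMl//; lra.
  have : 0 <= u * w <= w by nra.
  by rewrite /K ler_norml; lra.
rewrite (_ : _ - _ = (1 - u) * (x - y)); last by ring.
by rewrite normrM (le_lt_trans _ xy)// ger0_norm ?ler_piMl//; lra.
Qed.

Lemma continuous_segment_integral : continuous segment_integral.
Proof.
move=> x; apply/cvgrPdist_lt => e /(segment_integral_modulus x)[d d0 dP].
by apply/nbhs_ballP; exists d => //= y; exact: dP.
Qed.

(* The mean value theorem on each piece compares the Riemann sum with the increments of
   the primitive, which telescope. *)
Lemma riemann_sum_close (e : R) : 0 < e -> exists2 d : R, 0 < d &
  forall s c, tagged_partition 0 1 s c -> mesh_lt 0 1 s d -> forall x : R, 0 <= x <= b ->
  `|\sum_(i < size s) (nth 1 (0 :: s) i.+1 - nth 1 (0 :: s) i) *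
      h ((1 - c i) * x + c i * w) - segment_integral x| <= e.
Proof.
move=> e0; have [d d0 dP] := segment_unif_continuous 0 b ch e0.
have wb' := wb; have b1 : 0 < b + 1 by lra.
(* Replacing the tag [c i] by the mean point [u] moves the argument of [h] by [(c i - u) * (w - x)],
   where [w - x] is at most [b] in modulus for every [x]; the [+ 1] allows [b = 0]. *)
exists (d / (b + 1)) => [|s c sc sd x xb]; first by rewrite divr_gt0.
have ps := sc.1.
rewrite /segment_integral -(sum_telescope_partition (Phi x) ps) -sumrB.
apply: le_trans (ler_norm_sum _ _ _) _.
rewrite -[leRHS](_ : \sum_(i < size s) (nth 1 (0 :: s) i.+1 - nth 1 (0 :: s) i) * e = _).
  apply: ler_sum => i _.
  have [i0 i1 i2 ci] := tagged_partition_mem sc (ltn_ord i).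
  have [u ui ->] := primitive_mean x i0 (ltW i1) i2.
  set p := nth _ _ i in i0 i1 i2 ci ui *; set q := nth _ _ i.+1 in i1 i2 ci ui *.
  rewrite mulrC -mulrBl normrM mulrC gtr0_norm ?subr_gt0// ler_wpM2l ?subr_ge0 ?ltW//.
  apply: dP.
    by apply/andP; split; nra.
  rewrite (_ : _ - _ = (c i - u) * (w - x)); last by ring.
  have qpd : q - p < d / (b + 1) by exact: sd.
  have cu : `|c i - u| <= q - p by rewrite ler_norml; lra.
  have wx : `|w - x| <= b by rewrite ler_norml; lra.
  rewrite normrM; apply: (@le_lt_trans _ _ ((q - p) * b)); first exact: ler_pM.
  rewrite ltr_pdivlMr// in qpd; nra.
by rewrite -mulr_suml (sum_telescope_partition id ps) subr0 mul1r.
Qed.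

End ScalarIntegral.

(** Existence in the calculus is proved for functions continuous on the whole line, whereas [f] is
    continuous only on the half-line. Clamping the argument changes no value there. *)
Lemma continuous_clamp {R : realType} (f : R -> R) :
  {within [set` `[0, +oo[], continuous f} -> continuous (fun x : R => f (Num.max x 0)).
Proof.
move=> /subspace_continuousP cf x.
have := cf (Num.max x 0); rewrite /= in_itv/= andbT le_max lexx orbT => /(_ isT) fx.
have mx : Num.max y 0 @[y --> x] --> Num.max x 0.
  by apply: (@continuous_max R R idfun (cst 0) x); [exact: cvg_id|exact: cvg_cst].
move=> P /fx/mx Pf; apply: (@filterS R (nbhs x) _ _ _ _ Pf) => y /=; apply.
by rewrite /= in_itv/= andbT le_max lexx orbT.
Qed.

Lemma op_integral_unique {R : realType} {H : completeNormedModType R[i]}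
    (F : R -> H -> H) (J J' : H -> H) :
  (forall t : R, 0 <= t <= 1 -> bounded_operator (F t)) ->
  is_op_integral 0 1 F J -> is_op_integral 0 1 F J' -> J = J'.
Proof.
move=> bF [bJ FJ] [bJ' FJ']; apply: subr0_eq; apply: opnorm_le0; first exact: boundedB.
apply/ler_addgt0Pr => e e0; rewrite add0r.
have [|d d0 dP] := FJ (e / 2); first by rewrite divr_gt0.
have [|d' d'0 d'P] := FJ' (e / 2); first by rewrite divr_gt0.
have dd : 0 < Num.min d d' by rewrite lt_min d0.
have [s [c [sc sd]]] := exists_fine_partition dd.
have h1 : opnorm (riemann_sum 0 1 s c F - J) < e / 2.
  by apply: dP => // i /sd; rewrite lt_min => /andP[].
have h2 : opnorm (riemann_sum 0 1 s c F - J') < e / 2.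
  by apply: d'P => // i /sd; rewrite lt_min => /andP[].
have bS : bounded_operator (riemann_sum 0 1 s c F).
  apply: (big_ind (@bounded_operator R H)) => [||i _].
  - by rewrite -(scale0r (idfun : H -> H)); exact/boundedZ/bounded_id.
  - exact: boundedD.
  - apply/boundedZ/bF; have [a0 _ b1 /andP[ac cb]] := tagged_partition_mem sc (ltn_ord i).
    by rewrite (le_trans a0 ac) (le_trans cb b1).
have := opnormD (boundedB bJ bS) (boundedB bS bJ').
by rewrite subrKA (opnormB J (riemann_sum _ _ _ _ _)); lra.
Qed.

(** * The operator integral as a function of [B]; here [w] stands for the squared numerical
    radius *)

Section AffineIntegral.
Context {R : realType} {H : completeNormedModType R[i]}.
Variable dot : {dot H for (@conjC R[i])}.
Hypothesis norm_dot : forall x : H, `|x| ^+ 2 = dot x x.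
Hypothesis H_neq0 : exists x : H, x != 0.
Variables (B : H -> H) (w : R) (f : R -> R).
Hypotheses (bB : bounded_operator B) (sB : symmetric_operator dot B).
Hypothesis B_ge0 : forall x, 0 <= rdot dot (B x) x.
Hypothesis wB : 0 <= w <= opnorm B.
Hypothesis cf : {within [set` `[0, +oo[], continuous f}.

Lemma real_spectrum_ge0 (S : H -> H) (r : R) : bounded_operator S ->
  symmetric_operator dot S -> (forall x, 0 <= rdot dot (S x) x) ->
  real_spectrum S r -> 0 <= r.
Proof.
by move=> bS sS S0; apply: (spectrum_symmetric_ge norm_dot bS sS) => x; rewrite mul0r.
Qed.

Lemma is_funcalc_nonneg (S : H -> H) : bounded_operator S ->
  symmetric_operator dot S -> (forall x, 0 <= rdot dot (S x) x) ->
  is_funcalc (fun r => f (Num.max r 0)) S (funcalc f S).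
Proof.
move=> bS sS S0; have cf' := continuous_clamp cf.
have [C SC] := is_funcalc_exists norm_dot H_neq0 bS sS cf'.
have fS : is_funcalc f S C.
  apply: (is_funcalc_ext bS) SC => r rS.
  by congr f; apply/max_idPl; exact: real_spectrum_ge0 rS.
by rewrite (funcalcE norm_dot H_neq0 bS sS fS).
Qed.

Lemma opnorm_mem_spectrum : real_spectrum B (opnorm B).
Proof.
have [r rB <-] := opnorm_spectrum norm_dot H_neq0 bB sB.
by rewrite ger0_norm//; exact: real_spectrum_ge0 rB.
Qed.

Lemma real_spectrum_itv r : real_spectrum B r -> 0 <= r <= opnorm B.
Proof.
move=> rB; rewrite (real_spectrum_ge0 bB sB B_ge0 rB)/=.
exact: le_trans (ler_norm r) (spectrum_symmetric_norm norm_dot bB sB rB).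
Qed.

(** The integrand is [f] of an affine polynomial in [B], which is positive; [is_funcalc_comp_poly]
    rewrites it as a function of [B], the same operator for all [t]. *)
Lemma is_funcalc_affine (t : R) : 0 <= t <= 1 ->
  is_funcalc (fun r => f (Num.max ((1 - t) * r + t * w) 0)) B
    (funcalc f ((1 - t)%:C *: B + (t * w)%:C *: idfun)).
Proof.
move=> /andP[t0 t1]; pose q : {poly R} := (1 - t) *: 'X + (t * w)%:P.
have qE : (1 - t)%:C *: B + (t * w)%:C *: idfun = poly_operator q B.
  by rewrite /q poly_operatorD poly_operatorZ poly_operatorX poly_operatorC.
rewrite qE; apply: (is_funcalc_ext bB (f := fun r => f (Num.max q.[r] 0))).
  by move=> r _; rewrite /q !hornerE.
apply: (is_funcalc_comp_poly (f := fun r => f (Num.max r 0)) bB).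
apply: is_funcalc_nonneg; first exact: poly_operator_bounded.
  exact: symmetric_poly.
move=> x; rewrite -qE; have /andP[w0 _] := wB.
change (0 <= rdot dot ((1 - t)%:C *: B x + (t * w)%:C *: x) x).
rewrite (rdotDl dot) !(rdotZl dot) (rdotxx norm_dot) addr_ge0// mulr_ge0 ?subr_ge0//.
- by rewrite mulr_ge0.
- exact: sqr_ge0.
Qed.

(** A Riemann sum minus the candidate [J] represents the scalar Riemann sum minus [g], which is
    uniformly small on the spectrum; [funcalc_le] makes it small in norm. *)
Lemma op_integral_affine : exists2 g : R -> R,
  is_funcalc g B (op_integral 0 1 (fun t : R =>
    funcalc f ((1 - t)%:C *: B + (t * w)%:C *: idfun))) &
  forall r : R, exists2 u : R, 0 <= u <= 1 & g r = f (Num.max ((1 - u) * r + u * w) 0).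
Proof.
set F := fun t : R => _; have cf' := continuous_clamp cf.
have [Phi PhiP] := segment_primitive_exists w cf'.
exists (segment_integral Phi); last first.
  by move=> r; exact: (segment_integral_mean (h := fun x : R => f (Num.max x 0)) PhiP r).
have [J BJ] := is_funcalc_exists norm_dot H_neq0 bB sB (continuous_segment_integral cf' wB PhiP).
suff FJ : is_op_integral 0 1 F J.
  have -> // : op_integral 0 1 F = J.
  apply: xget_unique => // J' FJ'; apply: op_integral_unique FJ' FJ => t t01.
  by have [] := is_funcalc_affine t01.
split; first by case: BJ.
move=> e e0; have [|d d0 dP] := riemann_sum_close cf' wB PhiP (e := e / 2).
  by rewrite divr_gt0.
exists d => // s c sc sd; apply: (@le_lt_trans _ _ (e / 2)); last by lra.
have cP i : (i < size s)%N -> 0 <= c i <= 1.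
  move=> si; have [a0 _ b1 /andP[ac cb]] := tagged_partition_mem sc si.
  by rewrite (le_trans a0 ac) (le_trans cb b1).
have fS := is_funcalc_sum bB (n := size s)
  (fun i => nth 1 (0 :: s) i.+1 - nth 1 (0 :: s) i)
  (fun i si => is_funcalc_affine (cP i si)).
have := is_funcalcD bB fS (is_funcalcZ bB (-1) BJ); rewrite rmorphN1 scaleN1r => fSJ.
apply: (funcalc_le norm_dot H_neq0 bB sB fSJ) => r /real_spectrum_itv r01.
by rewrite /= mulN1r; exact: dP.
Qed.

End AffineIntegral.

Unset Implicit Arguments.
Set Strict Implicit.

Theorem theorem3p4 (R : realType) (H : completeNormedModType R[i])
    (dot : {dot H for (@conjC R[i])})
    (norm_dot : forall x : H, `|x| ^+ 2 = dot x x)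
    (H_neq0 : exists x : H, x != 0)
    (A : H -> H) (A_bounded : bounded_operator A)
    (f : R -> R)
    (f_ge0 : forall x : R, 0 <= x -> 0 <= f x)
    (f_incr : forall x y : R, 0 <= x -> x <= y -> f x <= f y)
    (f_opconvex : operator_convex dot `[0, +oo[ f)
    (alpha : R) (alpha01 : 0 <= alpha <= 1) :
  let abs_A := op_abs dot A in
  let abs_Astar := op_abs dot (adjoint dot A) in
  let w := numerical_radius dot A in
  let B : H -> H := alpha%:C *: (abs_A \o abs_A)
                    + (1 - alpha)%:C *: (abs_Astar \o abs_Astar) in
  let J : H -> H := op_integral 0 1 (fun t : R =>
    funcalc f ((1 - t)%:C *: B + (t * w ^+ 2)%:C *: idfun)) in
  f (w ^+ 2) <= opnorm J <= opnorm (funcalc f B).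
Proof.
lazy zeta; set w := numerical_radius dot A; set B : H -> H := _ + _.
set J := op_integral _ _ _; have [cf _] := f_opconvex.
have bB : bounded_operator B := comb_bounded norm_dot H_neq0 alpha A_bounded.
have sB : symmetric_operator dot B := comb_symmetric norm_dot H_neq0 alpha A_bounded.
have B0 : forall x, 0 <= rdot dot (B x) x :=
  rdot_comb_ge0 norm_dot H_neq0 A_bounded alpha01.
have wB : 0 <= w ^+ 2 <= opnorm B :=
  numerical_radius_sqr_le norm_dot H_neq0 A_bounded alpha01.
have [g gJ gP] := op_integral_affine norm_dot H_neq0 bB sB B0 wB cf.
have fB := is_funcalc_nonneg norm_dot H_neq0 cf bB sB B0.
have NB := opnorm_mem_spectrum norm_dot H_neq0 bB sB B0.
have /andP[w0 w1] := wB; have b0 := le_trans w0 w1.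
apply/andP; split.
  apply: le_trans (funcalc_ge norm_dot bB sB gJ NB); apply: le_trans (ler_norm _).
  (* The mean point for [r = opnorm B] lies between [w ^+ 2] and [opnorm B], hence is at least
     [w ^+ 2]. *)
  have [u /andP[u0 u1] ->] := gP (opnorm B); apply: f_incr => //.
  by rewrite le_max; apply/orP; left; nra.
apply: le_trans (funcalc_ge norm_dot bB sB fB NB); rewrite (max_idPl b0).
apply: (funcalc_le norm_dot H_neq0 bB sB gJ) => r rB.
have /andP[r0 r1] := real_spectrum_itv norm_dot bB sB B0 rB.
(* Both [r] and [w ^+ 2] are in [[0, opnorm B]], hence so is the mean point, and the clamp
   disappears. *)
have [u /andP[u0 u1] ->] := gP r.
have u_ge0 : 0 <= (1 - u) * r + u * w ^+ 2.
  by rewrite addr_ge0// mulr_ge0// subr_ge0.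
rewrite (max_idPl u_ge0) (ger0_norm (f_ge0 _ u_ge0)).
apply: le_trans (ler_norm _); apply: f_incr => //.
by nra.
Qed.
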